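(* Let $\mu$ be any (Borel) probability measure on $\mathbb{C}$, let $X_1,X_2,\ldots$ be independent identically distributed complex-valued random variables with distribution $\mu$, and put $P_n(z)=(z-X_1)\cdots(z-X_n)$. For $n\ge 2$ let $$\mu_n=\frac{1}{n-1}\sum_{z\in\mathbb{C}:\,P_n'(z)=0}\delta_z ,$$ where the roots of $P_n'$ are counted with multiplicities. Then the sequence $\mu_n$ converges as $n\to\infty$ to $\mu$ in probability; that is, for every open set $U\subset\mathbb{M}$ containing $\mu$, $$\lim_{n\to\infty}\mathbb{P}[\mu_n\notin U]=0 .$$
   Context: $\mathbb{M}$ denotes the set of Borel probability measures on $\mathbb{C}$ endowed with the topology of weak convergence (a Polish space). $\mu_n$ is viewed as a random element with values in $\mathbb{M}$, and $\mu$ as a deterministic point of $\mathbb{M}$. $\delta_z$ is the unit point mass at $z$. *)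

(* Defs.v *)
From HB Require Import structures.
From mathcomp Require Import all_boot all_order all_algebra finmap complex.
From mathcomp Require Import all_classical all_reals all_analysis.

Set Implicit Arguments.
Unset Strict Implicit.
Unset Printing Implicit Defensive.

Import Order.TTheory GRing.Theory Num.Theory.
Import numFieldNormedType.Exports.

Local Open Scope classical_set_scope.
Local Open Scope complex_scope.
Local Open Scope ring_scope.

(* The complex plane [R[i]]: the topology is that of the modulus, the
   sigma-algebra is the Borel one. *)
HB.instance Definition _ (R : realType) := NormedModule.copy R[i] R[i]^o.
HB.instance Definition _ (R : realType) :=
  Measurable.copy R[i] (g_sigma_algebraType (@open R[i])).

Definition bounded_continuous (R : realType) :=
  {f : R[i] -> R | continuous f /\ bounded_fun f}.

HB.instance Definition _ (R : realType) := gen_eqMixin (bounded_continuous R).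
HB.instance Definition _ (R : realType) :=
  gen_choiceMixin (bounded_continuous R).

Definition integral_map (R : realType) (nu : probability R[i] R) :
    {ptws bounded_continuous R -> R} :=
  fun f => \int[nu]_z sval f z.

(* The space of Borel probability measures with the topology of weak
   convergence, i.e. the coarsest one making [nu |-> \int[nu] f] continuous for
   every bounded continuous [f]. *)
Definition weak_probability (R : realType) : Type :=
  initial_topology (@integral_map R).

HB.instance Definition _ (R : realType) :=
  Topological.copy (weak_probability R) (initial_topology (@integral_map R)).

Definition mutually_independent d d' (T : measurableType d)
    (T' : measurableType d') (R : realType) (P : probability T R)
    (X : nat -> {RV P >-> T'}) : Prop :=
  forall (J : {fset nat}) (A : nat -> set T'),
    (forall j, j \in J -> measurable (A j)) ->
    P (\bigcap_(j in [set` J]) (X j @^-1` A j)) =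
    (\prod_(j <- J) P (X j @^-1` A j))%E.

Definition identically_distributed d d' (T : measurableType d)
    (T' : measurableType d') (R : realType) (P : probability T R)
    (X : nat -> {RV P >-> T'}) (mu : probability T' R) : Prop :=
  forall (j : nat) (A : set T'), measurable A -> distribution P (X j) A = mu A.

(* The sequence of points is indexed from 0: [poly_of x n] has the roots
   [x 0, .., x n.-1]. *)
Definition poly_of (F : comNzRingType) (x : nat -> F) (n : nat) : {poly F} :=
  \prod_(j < n) ('X - (x j)%:P).

(* [p = lead_coef p *: \prod_(z <- roots_of p) ('X - z%:P)]; for [p != 0] this
   lists the roots of [p] with their multiplicities. *)
Definition roots_of (F : closedFieldType) (p : {poly F}) : seq F :=
  sval (closed_field_poly_normal p).

(* The total mass is 1 only when [2 <= n], so the probability instance below is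
   attached to [critical_measure x n.+2]. *)
Definition critical_measure (R : realType) (x : nat -> R[i]) (n : nat)
    (A : set R[i]) : \bar R :=
  ((n.-1%:R^-1)%:E * \sum_(z <- roots_of (poly_of x n)^`()) \d_z A)%E.

Section critical_measure_is_probability.
Variables (R : realType) (x : nat -> R[i]).

Let cm0 n : critical_measure x n set0 = 0%E.
Proof. by rewrite /critical_measure big1 ?mule0// => z _; rewrite measure0. Qed.

Let cm_ge0 n A : (0 <= critical_measure x n A)%E.
Proof.
by apply: mule_ge0; [rewrite lee_fin invr_ge0|apply: sume_ge0].
Qed.

Let cm_sigma_additive n : semi_sigma_additive (critical_measure x n).
Proof.
have r0 : 0 <= n.-1%:R^-1 :> R by rewrite invr_ge0.
pose s := roots_of (poly_of x n)^`().
pose m := mscale (NngNum r0) (msum (fun j => \d_(nth 0 s j)) (size s)).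
rewrite (_ : critical_measure x n = m); first exact: measure_semi_sigma_additive.
apply/funext => A.
by rewrite /m /mscale /critical_measure /msum/= (big_nth 0) big_mkord.
Qed.

HB.instance Definition _ n := isMeasure.Build _ _ _ (critical_measure x n)
  (cm0 n) (cm_ge0 n) (@cm_sigma_additive n).

Lemma size_poly_of (n : nat) : size (poly_of x n) = n.+1.
Proof. by rewrite /poly_of size_prod_XsubC /index_enum -enumT size_enum_ord. Qed.

Lemma size_deriv_poly_of (n : nat) : size (poly_of x n.+1)^`() = n.+1.
Proof.
have p0 : poly_of x n.+1 != 0 by rewrite -size_poly_eq0 size_poly_of.
apply/eqP; rewrite eqn_leq; apply/andP; split.
  by have := lt_size_deriv p0; rewrite size_poly_of ltnS.
rewrite ltnNge; apply/negP => /leq_sizeP/(_ n (leqnn _)).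
have : lead_coef (poly_of x n.+1) = 1 by apply/monicP/monic_prod_XsubC.
rewrite lead_coefE size_poly_of coef_deriv/= => -> /eqP.
by rewrite pnatr_eq0.
Qed.

Lemma size_roots_of_deriv (n : nat) :
  size (roots_of (poly_of x n.+1)^`()) = n.
Proof.
rewrite /roots_of; case: closed_field_poly_normal => s /= /(congr1 (fun p : {poly R[i]} => size p)).
rewrite size_deriv_poly_of size_scale; first by rewrite size_prod_XsubC => -[].
by rewrite lead_coef_eq0 -size_poly_eq0 size_deriv_poly_of.
Qed.

Let cmT n : critical_measure x n.+2 setT = 1%:E.
Proof.
rewrite /critical_measure (eq_bigr (fun=> 1%:E)); last by move=> z _; rewrite diracT.
rewrite sumEFin big_const_seq count_predT size_roots_of_deriv/= iter_addr addr0.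
by rewrite -EFinM nat1r mulVf// pnatr_eq0.
Qed.

HB.instance Definition _ n := Measure_isProbability.Build _ _ _
  (critical_measure x n.+2) (cmT n).

End critical_measure_is_probability.

(* Main.v *)
Require Import Defs.
From HB Require Import structures.
From mathcomp Require Import all_boot all_order all_algebra finmap complex.
From mathcomp Require Import all_classical all_reals all_analysis.
From mathcomp Require Import measurable_realfun ring lra.

Set Implicit Arguments.
Unset Strict Implicit.
Unset Printing Implicit Defensive.

Import Order.TTheory GRing.Theory Num.Theory.
Import numFieldNormedType.Exports.
Import ComplexField.Normc.

Local Open Scope classical_set_scope.
Local Open Scope complex_scope.
Local Open Scope ring_scope.

(* Write |.| for the modulus and L_n = P_n'/P_n = sum_i 1/(z - X_i).  By Jensen's
   formula the average of log |z - y| over the circle |z - c| = r is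
   k(y) = log max(r, |y - c|).  The heart of the proof is that, for all c and r,
   the sums of k over the critical points and over the roots of P_n differ by
   o(n) in probability.

   Jensen's formula is replaced by its discrete version
   prod_u (w - r u) = w^N - r^N over the N-th roots of unity u, applied to
   |P_n'| = |P_n| |L_n| at the points c + r u.

   - The sum over the critical points is not much larger, deterministically: some
     circle of radius close to r keeps a distance at least a/(4n) from all
     the roots, so that |L_n| <= 4n^2/a on it; then let N tend to infinity.
   - It is not much smaller, with high probability: N is now fixed, and for each
     fixed point z that is not an atom of mu the event |L_n(z)| <= e has
     probability o(1), by an anticoncentration inequality for sums of i.i.d.
     variables.  The radius is chosen such that log | |X - c| - r | is integrable,
     which holds for almost every r.

   Differences of two such functions k are continuous, compactly supported bumps.
   Their linear combinations approximate every bounded continuous function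
   uniformly on discs, while staying bounded elsewhere, and the law of large
   numbers for the X_i concludes. *)

(** * Discrete Jensen formula *)

Section modulus.
Variable R : realType.
Implicit Types (z w c : R[i]) (s : seq R[i]).

(** The measure mu is arbitrary, so log |X - c| need not be integrable and the potentials may have
    no mean. Sums over critical points are therefore compared with sums over the sample, and means
    under mu are taken only of bounded functions. The two halves of the comparison cannot use the
    same circle. In the upper half the circle depends on the sample, and infinitely many test points
    cost nothing because the bound is deterministic. In the lower half anticoncentration gives no
    rate and treats one point at a time, so the circle and its finitely many test points are fixed
    before n. The price is the error of the discrete formula, a sum over the sample divided by N,
    which Markov's inequality controls. Escape of critical points to infinity is excluded by
    applying the comparison to one wide bump. Measurability is postponed: exceptional sets are only
    covered by small measurable sets, until continuity of the roots shows that the event of the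
    theorem is measurable. *)

Lemma normc_ge0 z : 0 <= normc z.
Proof. by case: z => a b; exact: sqrtr_ge0. Qed.

Lemma normc_gt0 z : (0 < normc z) = (z != 0).
Proof.
rewrite lt_def normc_ge0 andbT; congr (~~ _); apply/eqP/eqP => [/eq0_normc//|->].
exact: normc0.
Qed.

Lemma normcD z w : normc (z + w) <= normc z + normc w.
Proof. exact: le_normcD. Qed.

Lemma normcBC z w : normc (z - w) = normc (w - z).
Proof. by rewrite -[LHS]normcN opprB. Qed.

Lemma normcB z w : normc z - normc w <= normc (z - w).
Proof. by rewrite lerBlDr (le_trans _ (normcD _ _))// subrK. Qed.

Lemma normcB_abs z w : `|normc z - normc w| <= normc (z - w).
Proof.
by rewrite ler_norml normcB andbT lerNl opprB normcBC normcB.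
Qed.

Lemma normcX z n : normc (z ^+ n) = normc z ^+ n.
Proof.
elim: n => [|n IH]; first by rewrite !expr0 normc1.
by rewrite !exprS normcM IH.
Qed.

Lemma normc_real (x : R) : normc (x%:C) = `|x|.
Proof. by rewrite /normc /= expr0n addr0 sqrtr_sqr. Qed.

Lemma normc_nat n : normc (n%:R : R[i]) = n%:R.
Proof. by rewrite -(rmorph_nat (real_complex R)) normc_real normr_nat. Qed.

Lemma normc_prod I (r : seq I) (F : I -> R[i]) :
  normc (\prod_(i <- r) F i) = \prod_(i <- r) normc (F i).
Proof. by apply: (big_morph _ (@normcM R)); exact: normc1. Qed.

Lemma normc_sum I (r : seq I) (F : I -> R[i]) :
  normc (\sum_(i <- r) F i) <= \sum_(i <- r) normc (F i).
Proof.
elim/big_ind2 : _ => [|x1 x2 y1 y2 h1 h2|//]; first by rewrite normc0.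
by rewrite (le_trans (normcD _ _))// lerD.
Qed.

Lemma le_Re_normc z : `|complex.Re z| <= normc z.
Proof.
case: z => a b /=; rewrite -[leLHS]sqrtr_sqr ler_wsqrtr// lerDl sqr_ge0//.
Qed.

Lemma le_Im_normc z : `|complex.Im z| <= normc z.
Proof.
case: z => a b /=; rewrite -[leLHS]sqrtr_sqr ler_wsqrtr// lerDr sqr_ge0//.
Qed.

Lemma normc_le_ReIm z : normc z <= `|complex.Re z| + `|complex.Im z|.
Proof.
case: z => a b /=.
rewrite -[leRHS]ger0_norm ?addr_ge0// -[leRHS]sqrtr_sqr ler_wsqrtr//.
rewrite sqrrD !real_normK ?num_real// -addrA lerD2l lerDr.
by rewrite mulrn_wge0// mulr_ge0.
Qed.

Lemma prod_unity_roots N : (0 < N)%N -> exists2 u : seq R[i],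
  size u = N /\ {in u, forall z, normc z = 1} &
  forall v, \prod_(z <- u) (v - z) = v ^+ N - 1.
Proof.
move=> N0; pose p : {poly R[i]} := 'X^N - 1%:P.
have [u pE] := closed_field_poly_normal p.
have lp : lead_coef p = 1 by exact: lead_coefXnsubC.
rewrite lp scale1r in pE.
have hornp v : p.[v] = v ^+ N - 1 by rewrite /p !hornerE.
exists u.
  split.
    by have := size_XnsubC (1 : R[i]) N0; rewrite -/p pE size_prod_XsubC => -[].
  move=> z zu; have : root p z by rewrite pE root_prod_XsubC.
  rewrite rootE hornp subr_eq0 => /eqP zN1.
  have := congr1 (@normc R) zN1; rewrite normcX normc1 => /eqP.
  by rewrite pexpr_eq1// ?normc_ge0// => /eqP.
move=> v; rewrite -hornp pE horner_prod; apply: eq_bigr => z _.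
by rewrite !hornerE.
Qed.

(** [ln (far c r w)] is k(w) of the overview; [gap] is the distance from w to the circle, on which
    the error of the discrete formula depends. *)
Definition far (c : R[i]) (r : R) (w : R[i]) := Num.max r (normc (w - c)).
Definition gap (c : R[i]) (r : R) (w : R[i]) := `|normc (w - c) - r|.

Lemma far_gt0 c r w : 0 < r -> 0 < far c r w.
Proof. by move=> r0; rewrite /far lt_max r0. Qed.

Lemma gap_ge0 c r w : 0 <= gap c r w.
Proof. exact: normr_ge0. Qed.

(** The product is |(w - c)^N - r^N|. If M and m are the larger and the smaller of |w - c| and r,
    then M^N - m^N >= M^(N-1) (M - m) and M^N + m^N <= 2 M^N. The factors lost, [gap / far] and 2,
    do not depend on N. *)
Lemma circle_points (c : R[i]) (r : R) N : 0 < r -> (0 < N)%N ->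
  exists2 s : seq R[i], size s = N /\ {in s, forall z, normc (z - c) = r} &
  forall w, far c r w ^+ N.-1 * gap c r w <=
              \prod_(z <- s) normc (w - z) <= 2 * far c r w ^+ N.
Proof.
move=> r0 N0; have [u [su u1] uE] := prod_unity_roots N0.
have rC0 : r%:C != 0 :> R[i] by rewrite -normc_gt0 normc_real gtr0_norm.
exists [seq c + r%:C * z | z <- u].
  split; first by rewrite size_map.
  move=> _ /mapP[z /u1 zu ->].
  by rewrite addrAC subrr add0r normcM zu mulr1 normc_real gtr0_norm.
move=> w; rewrite big_map -normc_prod.
have -> : \prod_(z <- u) (w - (c + r%:C * z)) = (w - c) ^+ N - r%:C ^+ N.
  transitivity (\prod_(z <- u) (r%:C * ((w - c) / r%:C - z))).
    by apply: eq_bigr => z _; field.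
  rewrite big_split/= uE big_const_seq count_predT su iter_mulr_1.
  by rewrite expr_div_n mulrBr mulr1 mulrCA divff ?mulr1// expf_neq0.
have nrC : normc (r%:C : R[i]) = r by rewrite normc_real gtr0_norm.
case: N N0 su uE => // N _ _ _; rewrite /= /far /gap; apply/andP; split; last first.
  rewrite (le_trans (normcD _ _))// normcN !normcX nrC mulr_natl mulr2n.
  have h0 := normc_ge0 (w - c).
  rewrite lerD// lerXn2r// ?nnegrE// ?le_max ?lexx ?orbT ?(ltW r0)//.
apply: le_trans (normcB_abs _ _); rewrite !normcX nrC.
have := normc_ge0 (w - c); set a := normc _ => a0.
case: (leP r a) => ra.
  rewrite ger0_norm ?subr_ge0// ger0_norm ?subr_ge0; last first.
    by rewrite lerXn2r// nnegrE ltW.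
  rewrite mulrBr -exprSr lerD2l lerN2 exprSr.
  by rewrite ler_wpM2r ?(ltW r0)// lerXn2r// nnegrE ltW.
rewrite distrC [in leRHS]distrC.
rewrite ger0_norm ?subr_ge0 ?(ltW ra)// ger0_norm ?subr_ge0; last first.
  by rewrite lerXn2r// ?nnegrE ltW.
rewrite mulrBr -exprSr lerD2l lerN2 exprSr.
by rewrite ler_wpM2r// lerXn2r// ?nnegrE ltW.
Qed.

End modulus.

(** * Critical points and roots on circles *)

Section critical_points.
Variable R : realType.
Implicit Types (z w c y : R[i]) (s p : seq R[i]) (r e : R).

Lemma ln_prod (I : eqType) (t : seq I) (F : I -> R) : {in t, forall i, 0 < F i} ->
  ln (\prod_(i <- t) F i) = \sum_(i <- t) ln (F i).
Proof.
elim: t => [|i r IH] F0; first by rewrite !big_nil ln1.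
rewrite !big_cons lnM ?posrE ?IH ?F0 ?mem_head//.
  by move=> j jr; rewrite F0// in_cons jr orbT.
rewrite big_seq prodr_gt0// => j jr; rewrite F0// in_cons jr orbT//.
Qed.

Definition crit s : seq R[i] := roots_of (\prod_(z <- s) ('X - z%:P))^`().

(** L_n of the overview for the roots [s]. A term with x = z is 0 because the inverse of 0 is 0, so
    this is the logarithmic derivative only off [s]. *)
Definition cauchy s z : R[i] := \sum_(x <- s) (z - x)^-1.

Lemma prod_XsubC_poly_of s :
  \prod_(z <- s) ('X - z%:P) = poly_of (nth 0 s) (size s).
Proof. by rewrite (big_nth 0) big_mkord. Qed.

Lemma size_crit s n : size s = n.+1 -> size (crit s) = n.
Proof. by move=> sn; rewrite /crit prod_XsubC_poly_of sn size_roots_of_deriv. Qed.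

Lemma deriv_crit s n : size s = n.+1 ->
  (\prod_(z <- s) ('X - z%:P))^`() =
  n.+1%:R *: \prod_(z <- crit s) ('X - z%:P).
Proof.
move=> sn; rewrite /crit /roots_of; case: closed_field_poly_normal => t /= ->.
congr (_ *: _); rewrite lead_coefE prod_XsubC_poly_of sn size_deriv_poly_of.
have : lead_coef (poly_of (nth 0 s) n.+1) = 1.
  by apply/monicP/monic_prod_XsubC.
by rewrite lead_coefE size_poly_of coef_deriv/= => ->.
Qed.

Lemma horner_deriv_prod s z : z \notin s ->
  (\prod_(x <- s) ('X - x%:P))^`().[z] =
  \prod_(x <- s) (z - x) * cauchy s z.
Proof.
rewrite /cauchy; elim: s => [|x s IH] zs.
  by rewrite !big_nil derivC horner0 mulr0.
move: zs; rewrite in_cons negb_or => /andP[zx zs].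
rewrite !big_cons derivM derivXsubC mul1r !hornerE IH// horner_prod.
have {}zx : z - x != 0 by rewrite subr_eq0.
under eq_bigr do rewrite !hornerE.
by field.
Qed.

Lemma normc_deriv_crit s n z : size s = n.+1 -> z \notin s ->
  n.+1%:R * \prod_(y <- crit s) normc (z - y) =
  \prod_(x <- s) normc (z - x) * normc (cauchy s z).
Proof.
move=> sn zs; rewrite -!normc_prod -normcM -horner_deriv_prod//.
rewrite (deriv_crit sn) hornerZ normcM normc_nat horner_prod.
by congr (_ * normc _); apply: eq_bigr => y _; rewrite !hornerE.
Qed.

(** P' = P L multiplied over the test points; the leading coefficient [n.+1] of P' enters once per
    test point. Exchanging the products leaves, for each root or critical point, the product
    estimated by [circle_points]. *)
Lemma normc_deriv_crit_points s n p : size s = n.+1 ->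
  {in p, forall z, z \notin s} ->
  n.+1%:R ^+ size p * \prod_(y <- crit s) \prod_(z <- p) normc (y - z) =
  \prod_(x <- s) \prod_(z <- p) normc (x - z) *
  \prod_(z <- p) normc (cauchy s z).
Proof.
move=> sn ps.
rewrite [in LHS]exchange_big [in RHS]exchange_big/= -big_split/=.
rewrite -iter_mulr_1 -(@count_predT _ p) -big_const_seq -big_split/=.
rewrite big_seq [RHS]big_seq; apply: eq_bigr => z zp.
under eq_bigr do rewrite normcBC.
under [in RHS]eq_bigr do rewrite normcBC.
exact: normc_deriv_crit (ps _ zp).
Qed.

Definition lnfar c r s : R := \sum_(y <- s) ln (far c r y).

Lemma lnfar_le c r r' s : 0 < r -> r <= r' -> lnfar c r s <= lnfar c r' s.
Proof.
move=> r0 rr'; apply: ler_sum => y _.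
rewrite ler_ln ?posrE ?far_gt0//; last exact: lt_le_trans r0 rr'.
by rewrite /far ge_max !le_max rr' lexx orbT.
Qed.

(** Together with monotonicity this makes the radius adjustable: a change from r to r' costs at most
    ln (r' / r) per point, so bounds may be proved on a more convenient nearby circle. *)
Lemma ln_far_dilate c r r' y : 0 < r -> r <= r' ->
  ln (far c r' y) <= ln (far c r y) + ln (r' / r).
Proof.
move=> r0 rr'; have r'0 : 0 < r' by apply: lt_le_trans rr'.
rewrite -lnM ?posrE ?far_gt0 ?divr_gt0// ler_ln ?posrE ?far_gt0//; last first.
  by rewrite mulr_gt0 ?far_gt0 ?divr_gt0.
have q1 : 1 <= r' / r by rewrite ler_pdivlMr// mul1r.
rewrite {1}/far ge_max; apply/andP; split.
  rewrite -[leLHS](@divfK _ r) ?gt_eqF// mulrC ler_wpM2r ?(le_trans ler01)//.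
  by rewrite /far le_max lexx.
rewrite -[leLHS]mulr1 ler_pM ?normc_ge0//.
by rewrite /far le_max lexx orbT.
Qed.

Lemma lnfar_dilate c r r' s : 0 < r -> r <= r' ->
  lnfar c r' s <= lnfar c r s + (size s)%:R * ln (r' / r).
Proof.
move=> r0 rr'; rewrite /lnfar (_ : _ * _ = \sum_(y <- s) ln (r' / r)).
  by rewrite -big_split/=; apply: ler_sum => y _; exact: ln_far_dilate.
by rewrite big_const_seq count_predT iter_addr_0 mulr_natl.
Qed.

Lemma sum_const_seq I (t : seq I) (a : R) : \sum_(i <- t) a = (size t)%:R * a.
Proof. by rewrite big_const_seq count_predT iter_addr_0 mulr_natl. Qed.

Lemma prod_const_seq I (t : seq I) (a : R) : \prod_(i <- t) a = a ^+ size t.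
Proof. by rewrite big_const_seq count_predT iter_mulr_1. Qed.

Lemma mulrn_pred (a : R) N : (0 < N)%N -> a *+ N.-1 = N%:R * a - a.
Proof. by move=> N0; rewrite mulr_natl -{2}(prednK N0) mulrSr addrK. Qed.

(** This is how N is sent to infinity: all that is not proportional to N is collected in b. *)
Lemma le0_of_mulrn (a b : R) : (forall N, (0 < N)%N -> N%:R * a <= b) -> a <= 0.
Proof.
move=> h; rewrite leNgt; apply/negP => a0.
have := h (Num.truncn (`|b| / a)).+1 isT; apply/negP; rewrite -ltNge.
rewrite -ltr_pdivrMr//; apply: le_lt_trans (truncnS_gt _).
by rewrite ler_pM2r ?invr_gt0// ler_norm.
Qed.

Lemma circle_notin c r s p : {in s, forall x, 0 < gap c r x} ->
  {in p, forall z, normc (z - c) = r} -> {in p, forall z, z \notin s}.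
Proof.
move=> sg pc z zp; apply/negP => /sg.
by rewrite /gap (pc _ zp) subrr normr0 ltxx.
Qed.

(* The discrete Jensen formula with N points, as N tends to infinity. *)
Lemma lnfar_crit_off_circle c r e s n : size s = n.+1 -> 0 < r -> 0 < e ->
  {in s, forall x, e <= gap c r x} -> {in crit s, forall y, 0 < gap c r y} ->
  lnfar c r (crit s) <= lnfar c r s - ln e.
Proof.
move=> sn r0 e0 se sc; rewrite -subr_le0.
pose b := (size s)%:R * ln 2 + \sum_(y <- crit s) (ln (far c r y) - ln (gap c r y)).
apply: (@le0_of_mulrn _ b) => N N0.
have [p [pN pc] pw] := circle_points c r0 N0.
have sg : {in s, forall x, 0 < gap c r x}.
  by move=> x /se; exact: lt_le_trans.
have ps := circle_notin sg pc.
have := normc_deriv_crit_points sn ps; rewrite pN => eqN.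
(* Every root is at distance at least e from the circle, so each of the n + 1 terms has modulus at
   most 1 / e. *)
have Cz z : z \in p -> normc (cauchy s z) <= n.+1%:R / e.
  move=> zp; rewrite (le_trans (normc_sum _ _))//.
  apply: (@le_trans _ _ (\sum_(x <- s) e^-1)).
    rewrite big_seq [leRHS]big_seq; apply: ler_sum => x xs.
    rewrite normcV lef_pV2 ?posrE//; last first.
      by rewrite normc_gt0 subr_eq0; apply: contraNneq (ps _ zp) => ->.
    rewrite (le_trans (se _ xs))// /gap -(pc _ zp) distrC.
    by rewrite (le_trans (normcB_abs _ _))// opprB addrA subrK.
  by rewrite big_const_seq count_predT sn iter_addr_0 mulr_natl.
have : \prod_(y <- crit s) (far c r y ^+ N.-1 * gap c r y) * n.+1%:R ^+ N <=
    \prod_(x <- s) (2 * far c r x ^+ N) * (n.+1%:R / e) ^+ N.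
  apply: (@le_trans _ _ (n.+1%:R ^+ N *
      \prod_(y <- crit s) \prod_(z <- p) normc (y - z))).
    rewrite mulrC ler_wpM2l ?exprn_ge0//.
    apply: ler_prod => y _; have /andP[-> _] := pw y.
    by rewrite mulr_ge0 ?gap_ge0 ?exprn_ge0 ?ltW ?far_gt0.
  rewrite eqN ler_pM ?prodr_ge0//.
  - by move=> x _; rewrite prodr_ge0// => z _; exact: normc_ge0.
  - by move=> x _; exact: normc_ge0.
  - apply: ler_prod => y _; have /andP[_ ->] := pw y.
    by rewrite andbT prodr_ge0// => z _; exact: normc_ge0.
  - rewrite -{1}pN -prod_const_seq.
    rewrite big_seq [leRHS]big_seq; apply: ler_prod => z zp.
    by rewrite normc_ge0 Cz.
have nS : 0 < n.+1%:R :> R by rewrite ltr0n.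
have fN m y : 0 < far c r y ^+ m by rewrite exprn_gt0 ?far_gt0.
have P1 : 0 < \prod_(y <- crit s) (far c r y ^+ N.-1 * gap c r y).
  by rewrite big_seq prodr_gt0// => y yc; rewrite mulr_gt0 ?sc.
have P2 : 0 < \prod_(x <- s) (2 * far c r x ^+ N).
  by rewrite prodr_gt0// => y _; rewrite mulr_gt0.
have E1 : 0 < n.+1%:R ^+ N :> R by rewrite exprn_gt0.
have E0 : 0 < n.+1%:R / e by rewrite divr_gt0.
have E2 : 0 < (n.+1%:R / e) ^+ N by rewrite exprn_gt0.
rewrite -(ler_ln (mulr_gt0 P1 E1) (mulr_gt0 P2 E2)).
rewrite (lnM P1 E1) (lnM P2 E2) (lnXn _ nS) (lnXn _ E0).
rewrite ln_div// ln_prod; last by move=> y yc; rewrite mulr_gt0 ?sc.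
rewrite ln_prod; last by move=> y _; rewrite mulr_gt0.
have -> : \sum_(y <- crit s) ln (far c r y ^+ N.-1 * gap c r y) =
    N%:R * lnfar c r (crit s) - \sum_(y <- crit s) (ln (far c r y) - ln (gap c r y)).
  rewrite /lnfar mulr_sumr -sumrB big_seq [RHS]big_seq; apply: eq_bigr => y yc.
  rewrite lnM ?posrE ?sc// lnXn ?far_gt0//.
  by rewrite (mulrn_pred _ N0); lra.
have -> : \sum_(x <- s) ln (2 * far c r x ^+ N) =
    (size s)%:R * ln 2 + N%:R * lnfar c r s.
  rewrite /lnfar mulr_sumr -sum_const_seq -big_split/=; apply: eq_bigr => x _.
  by rewrite lnM ?posrE// lnXn ?far_gt0// mulr_natl.
(* The contributions N ln (n + 1) of the two sides cancel, which leaves only - N ln e next to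
   [b]. *)
rewrite /b -!(mulr_natl (ln _)).
set A := \sum_(y <- crit s) _; set B := (size s)%:R * _; move=> H.
by clear - H; lra.
Qed.

(** Pigeonhole: the [size t + 1] candidates r + l h are h apart, so a point of [t] is closer than h
    / 2 to at most one of them. *)
Lemma avoid_points (t : seq R) (r h : R) : 0 < h ->
  exists2 l : nat, (l <= size t)%N & {in t, forall x, h / 2 <= `|x - (r + l%:R * h)|}.
Proof.
move=> h0; apply: contrapT => nex.
have bad (l : 'I_(size t).+1) :
    exists i : 'I_(size t), `|nth 0 t i - (r + l%:R * h)| < h / 2.
  apply: contrapT => nb; apply: nex; exists l; first by rewrite -ltnS.
  move=> x xt; rewrite leNgt; apply/negP => xl; apply: nb.
  by exists (Ordinal (etrans (index_mem x t) xt)); rewrite /= nth_index.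
have /choice[f fP] := bad.
have f_inj : injective f.
  move=> i j fij; apply: val_inj; apply/eqP; rewrite -(eqr_nat R) /=.
  apply/negPn/negP => ij.
  have := fP i; rewrite fij; have := fP j; rewrite !ltr_norml => /andP[b1 b2] /andP[b3 b4].
  have : 1 <= `|i%:R - j%:R : R|.
    have [ltij|] := ltnP i j.
      by rewrite distrC ger0_norm ?subr_ge0 ?ler_nat ?(ltnW ltij)// lerBrDl natr1 ler_nat.
    rewrite leq_eqVlt => /orP[/eqP jj|ltij].
      by move: ij; rewrite jj eqxx.
    by rewrite ger0_norm ?subr_ge0 ?ler_nat ?(ltnW ltij)// lerBrDl natr1 ler_nat.
  rewrite ler_normr => /orP[] /(ler_wpM2r (ltW h0)); rewrite mul1r => k1.
    by clear - b1 b2 b3 b4 k1; lra.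
  by clear - b1 b2 b3 b4 k1; lra.
by have := leq_card f f_inj; rewrite !card_ord ltnn.
Qed.

Lemma lnfar_crit_upper c r e s n : size s = n.+1 -> 0 < r -> 0 < e ->
  lnfar c r (crit s) <=
  lnfar c r s + n.+1%:R * ln ((r + e) / r) + ln (4 * n.+1%:R / e).
Proof.
(* There are n + 1 roots and n critical points to avoid, hence 2n + 2 candidate radii; with this
   spacing none exceeds r + e. The critical points are avoided too because the logarithms of their
   gaps are taken. *)
move=> sn r0 e0; pose h := e / (2 * n.+1%:R).
have nS : 0 < n.+1%:R :> R by rewrite ltr0n.
have h0 : 0 < h by rewrite divr_gt0 ?mulr_gt0.
pose t := [seq normc (y - c) | y <- s ++ crit s].
have [l lt tl] := avoid_points t r h0.
have st : size t = (2 * n + 1)%N.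
  by rewrite size_map size_cat sn (size_crit sn) mul2n -addnn addn1 addSn.
have far_t y : y \in s ++ crit s -> h / 2 <= gap c (r + l%:R * h) y.
  by move=> ys; apply: tl; apply: map_f.
have lh0 : 0 <= l%:R * h by rewrite mulr_ge0// ltW.
have rr : r <= r + l%:R * h by rewrite lerDl.
have rl : r + l%:R * h <= r + e.
  rewrite lerD2l /h mulrCA -[leRHS]mulr1 ler_wpM2l ?(ltW e0)//.
  rewrite ler_pdivrMr ?mulr_gt0// mul1r -natrM ler_nat.
  by rewrite (leq_trans lt)// st mulnS addnC leq_add2r.
have h20 : 0 < h / 2 by rewrite divr_gt0.
have H : lnfar c (r + l%:R * h) (crit s) <=
    lnfar c (r + l%:R * h) s - ln (h / 2).
  apply: (lnfar_crit_off_circle sn (lt_le_trans r0 rr) h20).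
    by move=> x xs; apply: far_t; rewrite mem_cat xs.
  move=> y ys; apply: lt_le_trans h20 _; apply: far_t.
  by rewrite mem_cat ys orbT.
rewrite (_ : - ln (h / 2) = ln (4 * n.+1%:R / e)) in H; last first.
  by rewrite -lnV ?posrE// /h; congr ln; field; rewrite !gt_eqF.
apply: le_trans (lnfar_le c (crit s) r0 rr) _; apply: le_trans H _.
rewrite lerD2r; apply: le_trans (lnfar_dilate c s r0 rr) _.
rewrite sn lerD2l; apply: ler_wpM2l => //.
have q1 : 0 < (r + l%:R * h) / r by rewrite divr_gt0// (lt_le_trans r0).
have q2 : 0 < (r + e) / r by rewrite divr_gt0// addr_gt0.
by rewrite (ler_ln q1 q2) ler_pM2r ?invr_gt0.
Qed.

(** The same identity read the other way: the lower bounds of [circle_points] serve for the roots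
    and the upper bounds for the critical points, which may therefore lie on the circle. The errors
    keep their dependence on the number of test points, which will be fixed before n. *)
Lemma lnfar_crit_lower c r e s n p : size s = n.+1 -> 0 < r -> 0 < e ->
  (0 < size p)%N -> {in p, forall z, normc (z - c) = r} ->
  (forall w, far c r w ^+ (size p).-1 * gap c r w <=
     \prod_(z <- p) normc (w - z) <= 2 * far c r w ^+ size p) ->
  {in s, forall x, 0 < gap c r x} ->
  {in p, forall z, e <= normc (cauchy s z)} ->
  lnfar c r s - (size p)%:R^-1 * \sum_(x <- s) (ln (far c r x) - ln (gap c r x))
    + ln e - ln n.+1%:R - n%:R / (size p)%:R * ln 2 <= lnfar c r (crit s).
Proof.
move=> sn r0 e0 N0 pc pw sg pe; set N := size p in N0 pw *.
have ps := circle_notin sg pc.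
have := normc_deriv_crit_points sn ps => eqN.
have : \prod_(x <- s) (far c r x ^+ N.-1 * gap c r x) * e ^+ N <=
    n.+1%:R ^+ N * \prod_(y <- crit s) (2 * far c r y ^+ N).
  apply: (@le_trans _ _ (\prod_(x <- s) \prod_(z <- p) normc (x - z) *
      \prod_(z <- p) normc (cauchy s z))); last first.
    rewrite -eqN ler_wpM2l ?exprn_ge0//; apply: ler_prod => y _.
    have /andP[_ ->] := pw y.
    by rewrite andbT prodr_ge0// => z _; exact: normc_ge0.
  rewrite ler_pM ?exprn_ge0 ?(ltW e0)//.
  - by rewrite prodr_ge0// => x _; rewrite mulr_ge0 ?gap_ge0 ?exprn_ge0 ?ltW ?far_gt0.
  - apply: ler_prod => y _; have /andP[-> _] := pw y.
    by rewrite mulr_ge0 ?gap_ge0 ?exprn_ge0 ?ltW ?far_gt0.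
  - rewrite /N -prod_const_seq.
    rewrite big_seq [leRHS]big_seq; apply: ler_prod => z zp.
    by rewrite (ltW e0) pe.
have nS : 0 < n.+1%:R :> R by rewrite ltr0n.
have fN m y : 0 < far c r y ^+ m by rewrite exprn_gt0 ?far_gt0.
have P1 : 0 < \prod_(x <- s) (far c r x ^+ N.-1 * gap c r x).
  by rewrite big_seq prodr_gt0// => y yc; rewrite mulr_gt0 ?sg.
have P2 : 0 < \prod_(y <- crit s) (2 * far c r y ^+ N).
  by rewrite prodr_gt0// => y _; rewrite mulr_gt0.
have E1 : 0 < e ^+ N by rewrite exprn_gt0.
have E2 : 0 < n.+1%:R ^+ N :> R by rewrite exprn_gt0.
rewrite -(ler_ln (mulr_gt0 P1 E1) (mulr_gt0 E2 P2)).
rewrite (lnM P1 E1) (lnM E2 P2) (lnXn _ nS) (lnXn _ e0).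
rewrite ln_prod; last by move=> y yc; rewrite mulr_gt0 ?sg.
rewrite ln_prod; last by move=> y _; rewrite mulr_gt0.
have -> : \sum_(y <- s) ln (far c r y ^+ N.-1 * gap c r y) =
    N%:R * lnfar c r s - \sum_(y <- s) (ln (far c r y) - ln (gap c r y)).
  rewrite /lnfar mulr_sumr -sumrB big_seq [RHS]big_seq; apply: eq_bigr => y yc.
  rewrite lnM ?posrE ?sg// lnXn ?far_gt0//.
  by rewrite (mulrn_pred _ N0); lra.
have -> : \sum_(x <- crit s) ln (2 * far c r x ^+ N) =
    n%:R * ln 2 + N%:R * lnfar c r (crit s).
  rewrite /lnfar mulr_sumr -(size_crit sn) -sum_const_seq -big_split/=; apply: eq_bigr => x _.
  by rewrite lnM ?posrE// lnXn ?far_gt0// mulr_natl.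
rewrite -!(mulr_natl (ln _)).
have NR : 0 < N%:R :> R by rewrite ltr0n.
set A := \sum_(y <- s) _ => H.
rewrite -(ler_pM2l NR); apply: le_trans (_ : _ <= N%:R * lnfar c r s - A +
  N%:R * ln e - N%:R * ln n.+1%:R - n%:R * ln 2) _.
  rewrite le_eqVlt; apply/orP; left; apply/eqP; field; exact: lt0r_neq0.
by clear - H; lra.
Qed.

End critical_points.

(** * Independence and small events *)

Section bounded_measurable.
Context d (T : measurableType d) (R : realType) (P : probability T R).

Definition bmeas (f : T -> R) := measurable_fun setT f /\ exists M, forall x, `|f x| <= M.

Lemma bmeas_integrable (f : T -> R) : bmeas f -> P.-integrable setT (EFin \o f).
Proof.
move=> [mf [M fM]]; apply: measurable_bounded_integrable => //.
  by rewrite (@le_lt_trans _ _ 1%E) ?probability_le1 ?ltry.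
exists M; split; first exact: num_real.
by move=> K MK x _; apply: le_trans (fM x) _; exact: ltW.
Qed.

Lemma bmeas_cst (a : R) : bmeas (fun=> a).
Proof. by split; [exact: measurable_cst|exists `|a|]. Qed.

Lemma bmeasD (f g : T -> R) : bmeas f -> bmeas g -> bmeas (fun x => f x + g x).
Proof.
move=> [mf [M fM]] [mg [N gN]]; split; first exact: measurable_funD.
by exists (M + N) => x; rewrite (le_trans (ler_normD _ _))// lerD.
Qed.

Lemma bmeasM (f g : T -> R) : bmeas f -> bmeas g -> bmeas (fun x => f x * g x).
Proof.
move=> [mf [M fM]] [mg [N gN]]; split; first exact: measurable_funM.
by exists (M * N) => x; rewrite normrM ler_pM.
Qed.

Lemma bmeas_sum (I : eqType) (r : seq I) (f : I -> T -> R) :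
  (forall i, i \in r -> bmeas (f i)) -> bmeas (fun x => \sum_(i <- r) f i x).
Proof.
elim: r => [|i r IH] h.
  by under eq_fun do rewrite big_nil; exact: bmeas_cst.
under eq_fun do rewrite big_cons.
apply: bmeasD; first by apply: h; rewrite mem_head.
by apply: IH => j jr; apply: h; rewrite in_cons jr orbT.
Qed.

Lemma Rintegral_sum (I : eqType) (r : seq I) (f : I -> T -> R) :
  (forall i, i \in r -> bmeas (f i)) ->
  \int[P]_x (\sum_(i <- r) f i x) = \sum_(i <- r) \int[P]_x f i x.
Proof.
elim: r => [|i r IH] h.
  by under eq_Rintegral do rewrite big_nil; rewrite Rintegral_cst// mul0r big_nil.
have h' j : j \in r -> bmeas (f j) by move=> jr; apply: h; rewrite in_cons jr orbT.
under eq_Rintegral do rewrite big_cons.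
rewrite big_cons RintegralD ?IH//.
  by apply: bmeas_integrable; apply: h; rewrite mem_head.
by apply: bmeas_integrable; exact: bmeas_sum.
Qed.

Lemma bmeas_indic (A : set T) : measurable A -> bmeas (\1_A : T -> R).
Proof.
move=> mA; split; first exact: measurable_indic.
by exists 1 => x; rewrite indicE; case: (_ \in _); rewrite ?normr1 ?normr0.
Qed.

Lemma Rintegral_prob_cst (a : R) : \int[P]_x a = a.
Proof. rewrite Rintegral_cst//= (@probability_setT _ _ _ P) mulr1//. Qed.

Lemma bmeas_le (f g : T -> R) : bmeas f -> bmeas g -> (forall x, f x <= g x) ->
  \int[P]_x f x <= \int[P]_x g x.
Proof. by move=> bf bg fg; apply: le_Rintegral => //; exact: bmeas_integrable. Qed.

Lemma markov_bmeas (f : T -> R) (A : set T) (a : R) : bmeas f -> measurable A ->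
  0 < a -> (forall x, 0 <= f x) -> (forall x, A x -> a <= f x) ->
  (P A <= (a^-1 * \int[P]_x f x)%:E)%E.
Proof.
move=> bf mA a0 f0 Af.
have PA : P A \is a fin_num by rewrite fin_num_measure.
rewrite -(fineK PA) lee_fin ler_pdivlMl//.
have <- : \int[P]_x (a * \1_A x) = a * fine (P A).
  rewrite RintegralZl//.
      by rewrite /Rintegral integral_indic// setIT.
  exact/bmeas_integrable/bmeas_indic.
apply: bmeas_le => //.
  by apply: bmeasM; [exact: bmeas_cst|exact: bmeas_indic].
move=> x; rewrite indicE; have [xA|xA] := boolP (x \in A); last by rewrite mulr0.
by rewrite mulr1 Af//; exact: set_mem.
Qed.

End bounded_measurable.

Section independence.
Context d (T : measurableType d) (R : realType) (P : probability T R).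
Context d1 (T1 : measurableType d1) d2 (T2 : measurableType d2).

(* The extra event [D], independent of the pair, is what the induction proving
   [psum_independent] feeds on. *)
Lemma joint_law (U : {mfun T >-> T1}) (V : {mfun T >-> T2}) (D : set T) :
  measurable D ->
  (forall A B, measurable A -> measurable B ->
    P (U @^-1` A `&` V @^-1` B `&` D) = P (U @^-1` A) * P (V @^-1` B) * P D)%E ->
  forall C, measurable C ->
    P ((fun x => (U x, V x)) @^-1` C `&` D) =
    ((distribution P U \x distribution P V) C * P D)%E.
Proof.
move=> mD UV C mC.
have PD : P D \is a fin_num by rewrite fin_num_measure.
have pd0 : 0 <= fine (P D) by rewrite fine_ge0.
pose k := NngNum pd0.
have mUV : measurable_fun setT (fun x => (U x, V x)).
  by apply: measurable_fun_pair; exact: measurable_funPT.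
pose m' := pushforward (mrestr P mD) (fun x => (U x, V x)).
(* The mass of [D] is put on the first marginal, so that [m'], which agrees with a product on
   rectangles, is that product by uniqueness. *)
pose m1 := mscale k (distribution P U).
have h1 : (m1 \x distribution P V)%E C = m' C.
  apply: product_measure_unique => //= A B mA mB.
  rewrite /m' /pushforward /mrestr /=.
  have -> : (fun x => (U x, V x)) @^-1` (A `*` B) = U @^-1` A `&` V @^-1` B by [].
  rewrite UV// /m1 /mscale/= /distribution /pushforward (fineK PD).
  by rewrite muleC muleA.
rewrite [LHS](_ : _ = m' C)// -h1 /product_measure1 /m1 ge0_integral_mscale//.
  by rewrite /= (fineK PD) muleC.
exact: measurable_fun_xsection.
Qed.

Lemma independent_Rintegral (U : {mfun T >-> T1}) (V : {mfun T >-> T2})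
    (f : T1 -> R) (g : T2 -> R) :
  (forall A B, measurable A -> measurable B ->
    P (U @^-1` A `&` V @^-1` B) = P (U @^-1` A) * P (V @^-1` B))%E ->
  bmeas f -> bmeas g ->
  \int[P]_x (f (U x) * g (V x)) = (\int[P]_x f (U x)) * \int[P]_x g (V x).
Proof.
move=> UV bf bg.
have mUV : measurable_fun setT (fun x => (U x, V x)).
  by apply: measurable_fun_pair; exact: measurable_funPT.
pose W : {mfun T >-> (T1 * T2)%type} :=
  HB.pack (fun x => (U x, V x)) (isMeasurableFun.Build _ _ _ _ _ mUV).
pose h : T1 * T2 -> \bar R := fun z => (f z.1 * g z.2)%:E.
have bh : bmeas (fun z : T1 * T2 => f z.1 * g z.2).
  case: bf => mf [M fM]; case: bg => mg [N gN]; split.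
    by apply: measurable_funM; apply: measurableT_comp.
  by exists (M * N) => z; rewrite normrM ler_pM.
pose PU := distribution P U; pose PV := distribution P V.
have bmc d' (T' : measurableType d') (Z : {mfun T >-> T'}) (e : T' -> R) :
    bmeas e -> bmeas (e \o Z).
  by move=> [me [M eM]]; split; [exact: measurableT_comp|exists M => x; exact: eM].
have law C : measurable C -> (PU \x PV)%E C = distribution P W C.
  move=> mC; have := @joint_law U V setT measurableT _ C mC.
  rewrite setIT probability_setT mule1 => <-// A B mA mB.
  by rewrite setIT mule1; exact: UV.
have mh : measurable_fun setT h by apply/measurable_EFinP; case: bh.
have ih : (PU \x PV)%E.-integrable setT h.
  apply: (@measurable_bounded_integrable _ _ _ _ (fun z : T1 * T2 => f z.1 * g z.2)) => //.
    by rewrite [ltLHS](law _ measurableT) probability_setT ltry.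
    by case: bh.
  case: bh => _ [M hM]; exists M; split; first exact: num_real.
  by move=> K MK x _; apply: le_trans (hM x) _; exact: ltW.
have -> : \int[P]_x (f (U x) * g (V x)) = fine (\int[(PU \x PV)%E]_z h z)%E.
  rewrite (eq_measure_integral (distribution P W)).
    rewrite integral_distribution//.
    apply: (@bmeas_integrable _ _ _ P (fun x => f (U x) * g (V x))).
    by apply: bmeasM; exact: bmc.
  by move=> A mA _; exact: law.
rewrite -integral12_prod_meas1//.
have iE d' (T' : measurableType d') (Z : {mfun T >-> T'}) (e : T' -> R) : bmeas e ->
    (\int[distribution P Z]_y (e y)%:E = (\int[P]_x e (Z x))%:E)%E.
  move=> be; rewrite integral_distribution//.
    by rewrite fineK//; apply: integrable_fin_num => //; apply: bmeas_integrable; exact: bmc.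
  - by apply/measurable_EFinP; case: be.
  - by apply: bmeas_integrable; exact: bmc.
rewrite (eq_integral (fun x => (\int[P]_x g (V x))%:E * (f x)%:E)%E); last first.
  move=> x _; rewrite /fubini_F /h/=.
  under eq_integral do rewrite EFinM.
  rewrite integralZl//; last exact: (@bmeas_integrable _ _ _ PV).
  by rewrite iE// muleC.
rewrite integralZl//; last exact: (@bmeas_integrable _ _ _ PU).
by rewrite iE// -EFinM/= mulrC.
Qed.

End independence.

Section partial_sums.
Context d (T : measurableType d) (R : realType) (P : probability T R).
Context d' (T' : measurableType d') (X : nat -> {RV P >-> T'}).
Hypothesis X_indep : mutually_independent X.

Definition cylinder (J : {fset nat}) (A : nat -> set T') :=
  \bigcap_(j in [set` J]) (X j @^-1` A j).

Lemma measurable_cylinder J A : (forall j, j \in J -> measurable (A j)) ->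
  measurable (cylinder J A).
Proof.
move=> mA; apply: fin_bigcap_measurable; first exact: finite_fset.
by move=> j /= /mA mAj; rewrite -[X in measurable X]setTI; exact: measurable_funPT.
Qed.

Lemma cylinderU1 J A n B : n \notin J ->
  cylinder (n |` J)%fset (fun j => if j == n then B else A j) =
  X n @^-1` B `&` cylinder J A.
Proof.
move=> nJ; rewrite /cylinder set_fsetU1 bigcap_setU1 eqxx; congr (_ `&` _).
by apply: eq_bigcapr => j /= jJ; case: eqP => // jn; rewrite -jn jJ in nJ.
Qed.

Lemma pair_independent i j (A B : set T') : i != j ->
  measurable A -> measurable B ->
  P (X i @^-1` A `&` X j @^-1` B) = (P (X i @^-1` A) * P (X j @^-1` B))%E.
Proof.
move=> ij mA mB.
have jni : j \notin [fset i]%fset by rewrite in_fset1 eq_sym.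
have mAB k : k \in (j |` [fset i])%fset -> measurable (if k == j then B else A).
  by case: eqP.
have := X_indep mAB; rewrite big_fsetU1//= big_seq_fset1 eqxx (negbTE ij).
rewrite -/(cylinder _ _) (cylinderU1 (fun=> A))//.
rewrite /cylinder set_fset1 bigcap_set1 setIC => ->.
by rewrite muleC.
Qed.

Variable f : T' -> R.
Hypothesis mf : measurable_fun setT f.

Definition psum n w := \sum_(j < n) f (X j w).

Lemma measurable_psum n : measurable_fun setT (psum n).
Proof.
apply: measurable_sum => j.
by apply: measurableT_comp => //; exact: measurable_funPT.
Qed.

(** The cylinder is kept arbitrary: in the inductive step the event on [X n] joins it, and the
    hypothesis for [psum n] then makes [psum n], [f (X n)] and the old cylinder independent
    together. *)
Lemma psum_independent n J A B : (forall j, j \in J -> (n <= j)%N) ->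
  (forall j, j \in J -> measurable (A j)) -> measurable B ->
  P (psum n @^-1` B `&` cylinder J A) =
  (P (psum n @^-1` B) * P (cylinder J A))%E.
Proof.
elim: n J A B => [|n IH] J A B Jn mA mB.
  have p0 w : psum 0 w = 0 by rewrite /psum big_ord0.
  have [B0|B0] := pselect (B 0).
    have -> : psum 0 @^-1` B = setT.
      by apply/seteqP; split => // w _; rewrite /= p0.
    by rewrite setTI probability_setT mul1e.
  have -> : psum 0 @^-1` B = set0.
    by apply/seteqP; split => // w; rewrite /= p0.
  by rewrite set0I measure0 mul0e.
have mU := measurable_psum n.
have mV : measurable_fun setT (f \o X n).
  by apply: measurableT_comp => //; exact: measurable_funPT.
pose U : {mfun T >-> R} := HB.pack (psum n) (isMeasurableFun.Build _ _ _ _ _ mU).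
pose V : {mfun T >-> R} := HB.pack (f \o X n) (isMeasurableFun.Build _ _ _ _ _ mV).
pose C : set (R * R) := (fun z => z.1 + z.2) @^-1` B.
have mC : measurable C.
  rewrite -[C]setTI; apply: (measurable_funD measurable_fst measurable_snd) => //.
have key J' A' : (forall j, j \in J' -> (n < j)%N) ->
    (forall j, j \in J' -> measurable (A' j)) ->
    P ((fun x => (U x, V x)) @^-1` C `&` cylinder J' A') =
    ((distribution P U \x distribution P V) C * P (cylinder J' A'))%E.
  move=> J'n mA'; apply: joint_law => //; first exact: measurable_cylinder.
  move=> A0 B0 mA0 mB0.
  have nJ' : n \notin J' by apply/negP => /J'n; rewrite ltnn.
  have mfB : measurable (f @^-1` B0) by rewrite -[X in measurable X]setTI; exact: mf.
  have mif k : k \in (n |` J')%fset -> measurable (if k == n then f @^-1` B0 else A' k).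
    by rewrite !inE; case: eqP => //= _; exact: mA'.
  rewrite -setIA -[V @^-1` B0]/(X n @^-1` (f @^-1` B0)) -cylinderU1//.
  rewrite IH//; last first.
    by move=> k; rewrite !inE => /orP[/eqP->//|/J'n/ltnW].
  rewrite -muleA; congr (_ * _)%E.
  rewrite {1}/cylinder X_indep// big_fsetU1//= eqxx; congr (_ * _)%E.
  rewrite /cylinder X_indep//; rewrite big_seq [RHS]big_seq.
  by apply: eq_bigr => k kJ; case: eqP => // kn; rewrite -kn kJ in nJ'.
have psumS : psum n.+1 @^-1` B = (fun x => (U x, V x)) @^-1` C.
  by apply/seteqP; split => w; rewrite /C /= /psum big_ord_recr.
rewrite psumS key//; congr (_ * _)%E.
(* The empty cylinder identifies the product measure of [C] with the probability of the event on the
   sum. *)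
have := key fset0 A (fun j => _) (fun j => _).
rewrite /cylinder set_fset0 bigcap_set0 setIT probability_setT mule1 => <-//.
Qed.

End partial_sums.

(** * Characteristic functions *)

Section trig_law.
Context d (T : measurableType d) (R : realType) (P : probability T R).
Variable f : T -> R.
Hypothesis mf : measurable_fun setT f.

(** Real and imaginary parts of the characteristic function of f; the sum of their squares is its
    squared modulus. *)
Definition chf_cos (t : R) := \int[P]_x cos (t * f x).
Definition chf_sin (t : R) := \int[P]_x sin (t * f x).

Lemma bmeas_cos t : bmeas (fun x => cos (t * f x)).
Proof.
split; last by exists 1 => x; exact: cos_max.
apply: (measurableT_comp (continuous_measurable_fun (@continuous_cos R))).
exact: measurable_funM.
Qed.

Lemma bmeas_sin t : bmeas (fun x => sin (t * f x)).
Proof.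
split; last by exists 1 => x; exact: sin_max.
apply: (measurableT_comp (continuous_measurable_fun (@continuous_sin R))).
exact: measurable_funM.
Qed.

Lemma cos_eq1 (u : R) : `|u| <= 1 -> cos u = 1 -> u = 0.
Proof.
move=> u1; rewrite -cos_norm -cos0 => /cos_inj H; apply/eqP; rewrite -normr_eq0.
apply/eqP/H; rewrite in_itv/= ?lexx ?pi_ge0// normr_ge0/= (le_trans u1)//.
by rewrite (le_trans _ (pi_ge2 R))// ler1n.
Qed.

(* E [(cos tf - c)^2 + (sin tf - s)^2] = 1 - (c^2 + s^2), where c and s are the
   means of cos tf and sin tf. *)
Lemma chf_eq1_ae t : 1 <= chf_cos t ^+ 2 + chf_sin t ^+ 2 ->
  {ae P, forall x, cos (t * f x) = chf_cos t /\ sin (t * f x) = chf_sin t}.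
Proof.
set c := chf_cos t; set s := chf_sin t => cs1.
pose h x := 1 + (c ^+ 2 + s ^+ 2) + ((- 2 * c) * cos (t * f x) + (- 2 * s) * sin (t * f x)).
have hE x : h x = (cos (t * f x) - c) ^+ 2 + (sin (t * f x) - s) ^+ 2.
  by rewrite /h; have := cos2Dsin2 (t * f x); clear; lra.
have h0 x : 0 <= h x by rewrite hE addr_ge0 ?sqr_ge0.
have bc := bmeas_cos t; have bs := bmeas_sin t.
have b1 : bmeas (fun x => (- 2 * c) * cos (t * f x))
  by apply: bmeasM => //; exact: bmeas_cst.
have b2 : bmeas (fun x => (- 2 * s) * sin (t * f x))
  by apply: bmeasM => //; exact: bmeas_cst.
have b3 := bmeasD b1 b2.
have bh : bmeas h by apply: bmeasD => //; exact: bmeas_cst.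
have Ih : \int[P]_x h x = 1 - (c ^+ 2 + s ^+ 2).
  rewrite /h RintegralD//; [|exact/bmeas_integrable/bmeas_cst|exact: bmeas_integrable].
  rewrite Rintegral_prob_cst RintegralD//; [|exact: bmeas_integrable|exact: bmeas_integrable].
  rewrite !RintegralZl//; [|exact: bmeas_integrable|exact: bmeas_integrable].
  by rewrite -/(chf_cos t) -/(chf_sin t) -/c -/s; ring.
have Ih0 : (\int[P]_x (h x)%:E = 0)%E.
  have hfin : (\int[P]_x (h x)%:E)%E \is a fin_num.
    by apply: integrable_fin_num => //; exact: bmeas_integrable.
  rewrite -(fineK hfin); congr EFin; apply/eqP; rewrite eq_le.
  rewrite [X in X && _](_ : _ = true); last by rewrite -/(Rintegral P setT h) Ih; apply/idP; rewrite subr_le0.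
  by apply: Rintegral_ge0.
have mh : measurable_fun setT (EFin \o h) by apply/measurable_EFinP; case: bh.
have : ae_eq P setT (EFin \o h) (cst 0%E).
  apply/ae_eq_integral_abs => //; rewrite -[RHS]Ih0; apply: eq_integral => x _.
  by rewrite /= ger0_norm.
apply: filterS => x /(_ I)[] /eqP; rewrite hE paddr_eq0 ?sqr_ge0// !sqrf_eq0 !subr_eq0.
by move=> /andP[/eqP-> /eqP->].
Qed.

(* Otherwise there are t_k -> 0 such that t_k f is almost surely constant
   modulo 2 pi, and then f itself is almost surely constant. *)
Lemma chf_lt1 : ~ (exists a, {ae P, forall x, f x = a}) ->
  exists2 T0, 0 < T0 &
    forall t, 0 < t <= T0 -> chf_cos t ^+ 2 + chf_sin t ^+ 2 < 1.
Proof.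
move=> nc; apply: contrapT => nT; apply: nc.
have ext (k : nat) : exists t, 0 < t <= k.+1%:R^-1 /\
    1 <= chf_cos t ^+ 2 + chf_sin t ^+ 2.
  apply: contrapT => nt; apply: nT; exists k.+1%:R^-1; first by rewrite invr_gt0.
  move=> t tk; rewrite ltNge; apply/negP => t1; apply: nt; by exists t.
have [t tP] := choice ext.
pose D x := forall k, cos (t k * f x) = chf_cos (t k) /\ sin (t k * f x) = chf_sin (t k).
have aeD : {ae P, forall x, D x}.
  by apply: ae_foralln => k; apply: chf_eq1_ae; have [] := tP k.
have [x0 Dx0] : exists x, D x.
  apply: contrapT => nD; case: aeD => A [mA A0 DA].
  have AT : A = setT by apply/seteqP; split => // x _; apply: DA => Dx; apply: nD; exists x.
  by move/eqP: A0; rewrite AT probability_setT eqe oner_eq0.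
exists (f x0); apply: filterS aeD => x Dx; apply/eqP; rewrite -subr_eq0; apply/eqP.
(* This index makes |t_k u| at most 1, where the cosine takes the value 1 only at 0. *)
set u := f x - f x0; pose k := Num.truncn `|u|.
have [/andP[t0 tk] _] := tP k.
have : t k * u = 0.
  apply: cos_eq1.
    rewrite normrM gtr0_norm// (le_trans (ler_wpM2r (normr_ge0 _) tk))//.
    by rewrite mulrC ler_pdivrMr// mul1r ltW// /k truncnS_gt.
  rewrite mulrBr cosB; have [-> ->] := Dx k; have [<- <-] := Dx0 k.
  by rewrite -!expr2 cos2Dsin2.
by move=> /eqP; rewrite mulf_eq0 gt_eqF//= => /eqP.
Qed.

End trig_law.

(** * Small events and the weak law of large numbers *)

Section small_events.
Context d (T : measurableType d) (R : realType) (P : probability T R).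
Implicit Types A B : nat -> set T.

(* The events [A n] need not be measurable, and the value of [P] at a
   nonmeasurable set is meaningless, hence the measurable cover [B]. *)
Definition small_events A := forall e : R, 0 < e -> \forall n \near \oo,
  exists B : set T, [/\ measurable B, A n `<=` B & (P B <= e%:E)%E].

Lemma small_events_sub A B : (\forall n \near \oo, A n `<=` B n) ->
  small_events B -> small_events A.
Proof.
move=> AB sB e e0; apply: filterS2 AB (sB e e0) => n ABn [C [mC BC PC]].
by exists C; split => //; exact: subset_trans BC.
Qed.

Lemma small_eventsU A B : small_events A -> small_events B ->
  small_events (fun n => A n `|` B n).
Proof.
move=> sA sB e e0; have e20 : 0 < e / 2 by rewrite divr_gt0.
apply: filterS2 (sA _ e20) (sB _ e20) => n [C [mC AC PC]] [D [mD BD PD]].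
exists (C `|` D); split; [exact: measurableU|exact: setUSS|].
rewrite (le_trans (measureU2 _ mC mD))// [e]splitr EFinD.
exact: leeD.
Qed.

Lemma small_events_bigcup (I : eqType) (r : seq I) (A : I -> nat -> set T) :
  (forall i, i \in r -> small_events (A i)) ->
  small_events (fun n => \bigcup_(i in [set` r]) A i n).
Proof.
elim: r => [|i r IH] h.
  by move=> e e0; near=> n; exists set0; split => //; [move=> x [j]|rewrite measure0 lee_fin ltW].
apply: (@small_events_sub _ (fun n => A i n `|` \bigcup_(j in [set` r]) A j n)).
  apply: nearW => n x [j /=]; rewrite in_cons => /orP[/eqP->|jr] Ax; first by left.
  by right; exists j.
apply: small_eventsU; first by apply: h; rewrite mem_head.
by apply: IH => j jr; apply: h; rewrite in_cons jr orbT.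
Unshelve. all: by end_near. Qed.

Lemma small_events_bound A (u : nat -> R) : (forall n, measurable (A n)) ->
  (\forall n \near \oo, P (A n) <= (u n)%:E)%E -> u @ \oo --> 0 -> small_events A.
Proof.
move=> mA Au u0 e e0.
have : \forall n \near \oo, u n < e by exact: (cvgr_lt 0).
apply: filterS2 Au => n Au ue; exists (A n); split => //.
by rewrite (le_trans Au)// lee_fin ltW.
Qed.

Lemma small_events_shift A k : small_events A -> small_events (fun n => A (n + k)%N).
Proof.
move=> sA e e0; have [N _ NP] := sA e e0; exists N => // n /= Nn.
by apply: NP => /=; rewrite (leq_trans Nn)// leq_addr.
Qed.

End small_events.

Section iid.
Context d (T : measurableType d) (R : realType) (P : probability T R).
Context d' (T' : measurableType d') (mu : probability T' R).
Variable X : nat -> {RV P >-> T'}.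
Hypothesis X_indep : mutually_independent X.
Hypothesis X_distr : identically_distributed X mu.

Lemma bmeas_comp_RV (f : T' -> R) j : bmeas f -> bmeas (fun w => f (X j w)).
Proof.
move=> [mf [M fM]]; split; last by exists M => w; exact: fM.
by apply: measurableT_comp => //; exact: measurable_funPT.
Qed.

Lemma Rintegral_RV (f : T' -> R) j : bmeas f ->
  \int[P]_w f (X j w) = \int[mu]_x f x.
Proof.
move=> bf; congr fine; rewrite [RHS](eq_measure_integral (distribution P (X j))).
  rewrite integral_distribution//; first by apply/measurable_EFinP; case: bf.
  exact: (@bmeas_integrable _ _ _ P (fun w => f (X j w)) (bmeas_comp_RV j bf)).
by move=> A mA _; apply/esym; exact: X_distr.
Qed.

Lemma preimage_RV A j : measurable A -> P (X j @^-1` A) = mu A.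
Proof. by move=> mA; rewrite -(X_distr j mA). Qed.

(** Independence and the vanishing mean kill the off-diagonal terms; each of the n diagonal ones is
    at most M^2. *)
Lemma second_moment (g : T' -> R) M n : bmeas g -> \int[mu]_x g x = 0 ->
  (forall x, `|g x| <= M) ->
  \int[P]_w (\sum_(j < n) g (X j w)) ^+ 2 <= n%:R * M ^+ 2.
Proof.
move=> bg g0 gM.
have bX j := bmeas_comp_RV j bg.
under eq_Rintegral do rewrite expr2 big_distrlr/=.
rewrite Rintegral_sum; last by move=> i _; apply: bmeas_sum => j _; exact: bmeasM.
rewrite [leRHS](_ : _ = \sum_(i < n) M ^+ 2); last first.
  by rewrite sumr_const card_ord mulr_natl.
apply: ler_sum => i _; rewrite Rintegral_sum; last by move=> j _; exact: bmeasM.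
rewrite (bigD1 i)//= big1 ?addr0; last first.
  move=> j ji; rewrite (@independent_Rintegral _ _ _ P _ _ _ _ (X i) (X j))//.
    by rewrite !Rintegral_RV// g0 mul0r.
  by move=> A B mA mB; apply: pair_independent => //; rewrite eq_sym.
rewrite -[leRHS](Rintegral_prob_cst P); apply: bmeas_le.
- exact: bmeasM.
- exact: bmeas_cst.
by move=> w; rewrite -expr2 -real_normK ?num_real// lerXn2r ?nnegrE// (le_trans _ (gM (X i w))).
Qed.

Lemma law_of_large_numbers (f : T' -> R) e : bmeas f -> 0 < e ->
  small_events P (fun n => [set w |
    e * n%:R <= `|\sum_(j < n) f (X j w) - n%:R * \int[mu]_x f x| ]).
Proof.
move=> bf e0; pose m := \int[mu]_x f x; pose g x := f x + - m.
have bg : bmeas g by apply: bmeasD => //; exact: bmeas_cst.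
have g0 : \int[mu]_x g x = 0.
  rewrite RintegralD//; last 2 first.
  - exact: bmeas_integrable.
  - exact/bmeas_integrable/bmeas_cst.
  by rewrite Rintegral_prob_cst subrr.
have [_ [M gM]] := bg.
have bX j := bmeas_comp_RV j bg.
have bS n : bmeas (fun w => \sum_(j < n) g (X j w)).
  by apply: bmeas_sum => j _; exact: bX.
have SE n w : \sum_(j < n) f (X j w) - n%:R * m = \sum_(j < n) g (X j w).
  by rewrite big_split/= sumr_const card_ord mulNrn mulr_natl.
have bS2 n : bmeas (fun w => (\sum_(j < n) g (X j w)) ^+ 2).
  under eq_fun do rewrite expr2; exact: bmeasM.
pose A n := [set w | e * n%:R <= `|\sum_(j < n) g (X j w)| ].
have mA n : measurable (A n).
  rewrite [A n](_ : _ = (fun w => `|\sum_(j < n) g (X j w)|) @^-1` `[e * n%:R, +oo[).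
    rewrite -[X in measurable X]setTI.
    have mS : measurable_fun setT (fun w => `|\sum_(j < n) g (X j w)|).
      by apply: measurableT_comp => //; case: (bS n).
    exact: mS.
  by apply/seteqP; split => w /=; rewrite in_itv/= andbT.
apply: (@small_events_sub _ _ _ _ _ A); first by apply: nearW => n w /=; rewrite SE.
apply: (@small_events_bound _ _ _ _ _ (fun n => M ^+ 2 / e ^+ 2 * n%:R^-1)) => //; last first.
  rewrite -[X in _ --> X](mulr0 (M ^+ 2 / e ^+ 2)); apply: cvgMr.
  apply/cvgrPdist_lt => /= t t0; near=> n.
  rewrite sub0r normrN ger0_norm ?invr_ge0//.
  rewrite invf_plt ?posrE//; last by rewrite ltr0n; near: n; exists 1%N.
  by near: n; exact: nbhs_infty_gtr.
exists 1%N => // n /= n1.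
have n0 : 0 < n%:R :> R by rewrite ltr0n.
apply: le_trans (@markov_bmeas _ _ _ P _ (A n) ((e * n%:R) ^+ 2) (bS2 n) (mA n) _ _ _) _.
- by rewrite exprn_gt0// mulr_gt0.
- by move=> w; exact: sqr_ge0.
- move=> w Aw; rewrite -[leRHS]real_normK ?num_real// lerXn2r ?nnegrE//.
  by rewrite mulr_ge0// ltW.
rewrite lee_fin.
have := second_moment n bg g0 gM; move=> H.
apply: le_trans (ler_wpM2l _ H) _; first by rewrite invr_ge0 sqr_ge0.
rewrite le_eqVlt; apply/orP; left; apply/eqP; field.
by rewrite !gt_eqF.
Unshelve. all: by end_near. Qed.

End iid.

(** * Anticoncentration *)

Lemma cos_ge_cos1 (R : realType) (u : R) : `|u| <= 1 -> cos 1 <= cos u.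
Proof.
have pi1 : 1 <= pi :> R by rewrite (le_trans _ (pi_ge2 R))// ler1n.
rewrite -(cos_norm u) le_eqVlt => /orP[/eqP->//|u1].
by rewrite ltW// ltr_cos// in_itv/= ?normr_ge0 ?ler01 ?pi1// (le_trans (ltW u1)).
Qed.

Section anticoncentration.
Context d (T : measurableType d) (R : realType) (P : probability T R).
Context d' (T' : measurableType d') (mu : probability T' R).
Variable X : nat -> {RV P >-> T'}.
Hypothesis X_indep : mutually_independent X.
Hypothesis X_distr : identically_distributed X mu.
Variable f : T' -> R.
Hypothesis mf : measurable_fun setT f.

Let mS n : measurable_fun setT (psum X f n) := measurable_psum X mf n.

Lemma psum_last_independent n (g : R -> R) (h : T' -> R) : bmeas g -> bmeas h ->
  \int[P]_w (g (psum X f n w) * h (X n w)) =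
  (\int[P]_w g (psum X f n w)) * \int[mu]_x h x.
Proof.
move=> bg bh; rewrite -(Rintegral_RV X_distr n bh).
pose U : {mfun T >-> R} := HB.pack (psum X f n) (isMeasurableFun.Build _ _ _ _ _ (mS n)).
apply: (@independent_Rintegral _ _ _ P _ _ _ _ U (X n)) => // A B mA mB.
have Xn : X n @^-1` B = cylinder X [fset n]%fset (fun=> B).
  by rewrite /cylinder set_fset1 bigcap_set1.
rewrite Xn (psum_independent X_indep mf)//.
by move=> j; rewrite in_fset1 => /eqP ->.
Qed.

Lemma bmeas_cos_id t : bmeas (fun s : R => cos (t * s)).
Proof. exact: (bmeas_cos (@measurable_id _ _ setT)). Qed.

Lemma bmeas_sin_id t : bmeas (fun s : R => sin (t * s)).
Proof. exact: (bmeas_sin (@measurable_id _ _ setT)). Qed.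

Lemma chf_psum t n :
  chf_cos P (psum X f n) t ^+ 2 + chf_sin P (psum X f n) t ^+ 2 =
  (chf_cos mu f t ^+ 2 + chf_sin mu f t ^+ 2) ^+ n.
Proof.
elim: n => [|n IH].
  rewrite expr0 /chf_cos /chf_sin.
  under eq_Rintegral do rewrite /psum big_ord0 mulr0 cos0.
  under [in X in _ + X]eq_Rintegral do rewrite /psum big_ord0 mulr0 sin0.
  by rewrite !Rintegral_prob_cst; ring.
rewrite [RHS]exprSr -IH.
have psumS w : t * psum X f n.+1 w = t * psum X f n w + t * f (X n w).
  by rewrite /psum big_ord_recr/= mulrDr.
have bX (h : T' -> R) : bmeas h -> bmeas (fun w => h (X n w)) by exact: bmeas_comp_RV.
have cc : bmeas (fun w => cos (t * psum X f n w) * cos (t * f (X n w))).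
  by apply: bmeasM; [exact: bmeas_cos|exact: (bX _ (bmeas_cos mf t))].
have ss : bmeas (fun w => -1 * (sin (t * psum X f n w) * sin (t * f (X n w)))).
  apply: bmeasM; first exact: bmeas_cst.
  by apply: bmeasM; [exact: bmeas_sin|exact: (bX _ (bmeas_sin mf t))].
have ss' : bmeas (fun w => sin (t * psum X f n w) * sin (t * f (X n w))).
  by apply: bmeasM; [exact: bmeas_sin|exact: (bX _ (bmeas_sin mf t))].
have sc : bmeas (fun w => sin (t * psum X f n w) * cos (t * f (X n w))).
  by apply: bmeasM; [exact: bmeas_sin|exact: (bX _ (bmeas_cos mf t))].
have cs : bmeas (fun w => cos (t * psum X f n w) * sin (t * f (X n w))).
  by apply: bmeasM; [exact: bmeas_cos|exact: (bX _ (bmeas_sin mf t))].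
have -> : chf_cos P (psum X f n.+1) t = chf_cos P (psum X f n) t * chf_cos mu f t
    - chf_sin P (psum X f n) t * chf_sin mu f t.
  rewrite /chf_cos /chf_sin; under eq_Rintegral do rewrite psumS cosD -mulN1r.
  rewrite RintegralD//; [|exact: bmeas_integrable|exact: bmeas_integrable].
  rewrite RintegralZl//; last exact: bmeas_integrable.
  rewrite (psum_last_independent n (bmeas_cos_id t) (bmeas_cos mf t)).
  rewrite (psum_last_independent n (bmeas_sin_id t) (bmeas_sin mf t)).
  by rewrite mulN1r.
have -> : chf_sin P (psum X f n.+1) t = chf_sin P (psum X f n) t * chf_cos mu f t
    + chf_cos P (psum X f n) t * chf_sin mu f t.
  rewrite /chf_cos /chf_sin; under eq_Rintegral do rewrite psumS sinD.
  rewrite RintegralD//; [|exact: bmeas_integrable|exact: bmeas_integrable].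
  rewrite (psum_last_independent n (bmeas_cos_id t) (bmeas_sin mf t)).
  by rewrite (psum_last_independent n (bmeas_sin_id t) (bmeas_cos mf t)).
by ring.
Qed.

Lemma chf_psum_cvg0 t : chf_cos mu f t ^+ 2 + chf_sin mu f t ^+ 2 < 1 ->
  (fun n => chf_cos P (psum X f n) t) @ \oo --> 0.
Proof.
set q := (X in X < 1) => q1.
have q0 : 0 <= q by rewrite addr_ge0 ?sqr_ge0.
apply/cvgrPdist_lt => /= e e0.
have := @cvg_expr R q; rewrite ger0_norm// => /(_ q1) qn.
have e20 : 0 < e ^+ 2 by rewrite exprn_gt0.
have : \forall n \near \oo, q ^+ n < e ^+ 2 by exact: (cvgr_lt 0 qn).
apply: filterS => n; rewrite /q -chf_psum => qe.
rewrite sub0r normrN -(@ltr_pXn2r _ 2%N)// ?nnegrE ?(ltW e0)//.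
rewrite real_normK ?num_real//; apply: le_lt_trans qe.
by rewrite lerDl sqr_ge0.
Qed.

(** Both sides are the squared modulus of sum_i exp(i t_i s). The left one is integrated term by
    term; the right one is visibly nonnegative, and large when all cosines are. *)
Lemma sum_cos_sqr (N : nat) (t : nat -> R) (s : R) :
  \sum_(i < N) \sum_(j < N) cos ((t i - t j) * s) =
  (\sum_(i < N) cos (t i * s)) ^+ 2 + (\sum_(i < N) sin (t i * s)) ^+ 2.
Proof.
rewrite !expr2 !big_distrlr/= -big_split/=; apply: eq_bigr => i _.
rewrite -big_split/=; apply: eq_bigr => j _.
by rewrite mulrBl cosB.
Qed.

Lemma measurable_psum_le n (a : R) : measurable [set w | `|psum X f n w| <= a].
Proof.
rewrite [X in measurable X](_ : _ = (fun w => `|psum X f n w|) @^-1` `]-oo, a]).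
  rewrite -[X in measurable X]setTI.
  have mN : measurable_fun setT (fun w => `|psum X f n w|).
    by apply: measurableT_comp => //; exact: mS.
  exact: mN.
by apply/seteqP; split => w /=; rewrite in_itv/=.
Qed.

(* Markov's inequality for |sum_(j < N) exp(i t_j S_n)|^2 with t_j = j T0 / N: it
   is at least (N cos 1)^2 when |S_n| <= 1 / T0, and its mean tends to N as n
   tends to infinity, since only the diagonal terms survive. *)
Lemma psum_anticoncentration_nondeg (T0 : R) : 0 < T0 ->
  (forall t, 0 < t <= T0 -> chf_cos mu f t ^+ 2 + chf_sin mu f t ^+ 2 < 1) ->
  small_events P (fun n => [set w | `|psum X f n w| <= T0^-1]).
Proof.
move=> T00 chf1 e e0.
have c1 := @cos1_gt0 R.
(* The bound [u n] from Markov's inequality tends to N / (N cos 1)^2 = 1 / (N cos^2 1), which this N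
   makes smaller than e. *)
pose N := (Num.truncn ((cos 1 ^+ 2 * e)^-1 : R)).+1.
have NR : 0 < N%:R :> R by rewrite ltr0n.
pose t i : R := i%:R / N%:R * T0.
pose K : R := (N%:R * cos 1) ^- 2.
have K0 : 0 < K by rewrite /K invr_gt0 exprn_gt0// mulr_gt0.
pose u n := K * \sum_(i < N) \sum_(j < N) chf_cos P (psum X f n) (t i - t j).
have ucvg : u @ \oo --> K * \sum_(i < N) \sum_(j < N) (i == j)%:R.
  apply: cvgMr; apply: cvg_big => [|i _]; first exact: add_continuous.
  apply: cvg_big => [|j _]; first exact: add_continuous.
  have neg n (a : R) : chf_cos P (psum X f n) (- a) = chf_cos P (psum X f n) a.
    by apply: eq_Rintegral => w _; rewrite mulNr cosN.
  have tlt (k l : 'I_N) : (k < l)%N -> 0 < t l - t k <= T0.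
    move=> kl; rewrite /t -mulrBl -mulrBl -natrB ?(ltnW kl)//.
    apply/andP; split; first by rewrite !mulr_gt0 ?invr_gt0// ltr0n subn_gt0.
    rewrite ger_pMl// ler_pdivrMr// mul1r ler_nat.
    by rewrite (leq_trans (leq_subr _ _))// ltnW.
  have [->|ij] := eqVneq i j.
    under eq_fun do rewrite subrr /chf_cos.
    rewrite (_ : (fun _ => _) = cst 1); first exact: cvg_cst.
    apply/funext => n; under eq_Rintegral do rewrite mul0r cos0.
    by rewrite Rintegral_prob_cst.
  move: ij; rewrite -val_eqE neq_ltn => /orP[ij|ij].
    under eq_fun do rewrite -neg opprB.
    exact/chf_psum_cvg0/chf1/tlt.
  exact/chf_psum_cvg0/chf1/tlt.
have limE : K * \sum_(i < N) \sum_(j < N) (i == j)%:R < e.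
  rewrite (eq_bigr (fun=> 1)); last first.
    move=> i _; rewrite (bigD1 i)//= eqxx big1 ?addr0// => j /negbTE.
    by rewrite eq_sym => ->.
  rewrite sumr_const card_ord /K.
  have -> : (N%:R * cos 1) ^- 2 * N%:R = (N%:R * cos 1 ^+ 2)^-1 :> R.
    by field; rewrite !gt_eqF.
  have c20 : 0 < cos 1 ^+ 2 :> R by rewrite exprn_gt0.
  rewrite invf_plt ?posrE ?mulr_gt0//.
  rewrite (_ : e^-1 = (cos 1 ^+ 2 * e)^-1 * cos 1 ^+ 2); last by field; rewrite !gt_eqF.
  by rewrite ltr_pM2r// truncnS_gt.
have : \forall n \near \oo, u n < e by exact: (cvgr_lt _ ucvg).
apply: filterS => n une; exists [set w | `|psum X f n w| <= T0^-1].
split=> //; first exact: measurable_psum_le.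
pose G w := \sum_(i < N) \sum_(j < N) cos ((t i - t j) * psum X f n w).
have bG : bmeas G.
  by apply: bmeas_sum => i _; apply: bmeas_sum => j _; exact: bmeas_cos.
have IG : \int[P]_w G w = \sum_(i < N) \sum_(j < N) chf_cos P (psum X f n) (t i - t j).
  rewrite Rintegral_sum; last first.
    by move=> i _; apply: bmeas_sum => j _; exact: bmeas_cos.
  by apply: eq_bigr => i _; rewrite Rintegral_sum// => j _; exact: bmeas_cos.
apply: le_trans (@markov_bmeas _ _ _ P G _ ((N%:R * cos 1) ^+ 2) bG (measurable_psum_le n _) _ _ _) _.
- by rewrite exprn_gt0// mulr_gt0.
- by move=> w; rewrite /G sum_cos_sqr addr_ge0 ?sqr_ge0.
- move=> w /= wT; rewrite /G sum_cos_sqr -[leLHS]addr0 lerD ?sqr_ge0//.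
  have cosT (i : 'I_N) : cos 1 <= cos (t i * psum X f n w).
    apply: cos_ge_cos1; rewrite normrM ger0_norm; last first.
      by rewrite /t !mulr_ge0 ?invr_ge0 ?(ltW T00).
    rewrite -[leRHS](@mulfV _ T0) ?gt_eqF// ler_pM//.
      by rewrite /t !mulr_ge0 ?invr_ge0 ?(ltW T00).
    rewrite /t ger_pMl// ler_pdivrMr// mul1r ler_nat.
    exact: ltnW.
  have sN : N%:R * cos 1 <= \sum_(i < N) cos (t i * psum X f n w).
    by rewrite mulr_natl -[X in _ *+ X]card_ord -sumr_const; exact: ler_sum.
  have N0 : 0 <= N%:R * cos 1 :> R by rewrite mulr_ge0// ltW.
  by rewrite lerXn2r ?nnegrE// (le_trans N0).
- by rewrite lee_fin IG ltW.
Qed.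

End anticoncentration.

(** * Topology and measurability of the complex plane *)

Section complex_topology.
Variable R : realType.
Implicit Types z w : R[i].

Lemma near_normc z (e : R) : 0 < e -> \forall w \near z, normc (w - z) < e.
Proof.
move=> e0; have eC : 0 < e%:C :> R[i] by rewrite ltcR.
have : \forall w \near z, ball z e%:C w by exact: nbhsx_ballx.
apply: filterS => w; rewrite -ball_normE /=.
by rewrite [X in X < _](_ : _ = (normc (z - w))%:C)// ltcR normcBC.
Qed.

Lemma nbhs_normc z (A : set R[i]) : nbhs z A ->
  exists2 e : R, 0 < e & forall w, normc (w - z) < e -> A w.
Proof.
(* The radius of a ball is a complex number here; its positivity means that it is real and
   positive. *)
move=> /nbhs_ballP[[a b] /= ]; rewrite ltcE/= => /andP[/eqP b0 a0] zA.
exists a => // w wz; apply: zA; rewrite -ball_normE /=.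
by rewrite [X in X < _](_ : _ = (normc (z - w))%:C)// ltcE/= b0 eqxx/= normcBC.
Qed.

Lemma continuous_normcP (f : R[i] -> R) :
  (forall z e, 0 < e -> exists2 t, 0 < t & forall w, normc (w - z) < t -> `|f z - f w| < e) ->
  continuous f.
Proof.
move=> h z; apply/(cvgrPdist_lt (FF := nbhs_filter z)) => /= e e0; have [t t0 zt] := h z e e0.
by have := near_normc z t0; apply: filterS => w /zt.
Qed.

Lemma continuous_lipschitz_normc (f : R[i] -> R) (K : R) : 0 < K ->
  (forall z w, `|f z - f w| <= K * normc (w - z)) -> continuous f.
Proof.
move=> K0 fK; apply: continuous_normcP => z e e0; exists (e / K); first exact: divr_gt0.
by move=> w wz; rewrite (le_lt_trans (fK z w))// mulrC -ltr_pdivlMr.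
Qed.

Lemma continuous_normcB c : continuous (fun z : R[i] => normc (z - c)).
Proof.
apply: (continuous_lipschitz_normc ltr01) => z w; rewrite mul1r [normc (w - z)]normcBC.
by apply: le_trans (normcB_abs _ _) _; rewrite opprB addrA subrK.
Qed.

Lemma continuous_measurable_complex (f : R[i] -> R) : continuous f -> measurable_fun setT f.
Proof.
move=> /continuousP cf; apply: (measurability _ (RGenOpens.measurableE R)).
move=> _ [_ [a [b ->] <-]]; rewrite setTI; apply: sub_sigma_algebra.
exact/cf/interval_open.
Qed.

Lemma measurable_inv_ge0 d (T : measurableType d) (f : T -> R) :
  measurable_fun setT f -> (forall x, 0 <= f x) -> measurable_fun setT (fun x => (f x)^-1).
Proof.
move=> mf f0; rewrite (_ : (fun _ => _) = (fun x => f x `^ (-1))).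
  exact: (measurableT_comp (measurable_powR (-1)) mf).
by apply/funext => x; rewrite powR_inv1.
Qed.

Lemma inv_complexE z : z^-1 = (complex.Re z / normc z ^+ 2) +i* (- (complex.Im z / normc z ^+ 2)).
Proof.
case: z => a b /=; rewrite sqr_sqrtr ?addr_ge0 ?sqr_ge0//.
Qed.

Lemma measurable_Re_inv z : measurable_fun setT (fun w : R[i] => complex.Re (z - w)^-1).
Proof.
under eq_fun do rewrite inv_complexE /=.
apply: measurable_funM.
  apply: continuous_measurable_complex.
  apply: (continuous_lipschitz_normc ltr01) => u w; rewrite mul1r.
  by move: z u w => [a b] [a1 b1] [a2 b2]; rewrite /= [X in Num.norm X](_ : _ = a2 - a1); [exact: (le_Re_normc ((a2 - a1) +i* (b2 - b1)))|ring].
apply: measurable_inv_ge0; last by move=> w; exact: sqr_ge0.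
apply: measurable_funX; under eq_fun do rewrite normcBC.
exact: (continuous_measurable_complex (@continuous_normcB z)).
Qed.

Lemma measurable_Im_inv z : measurable_fun setT (fun w : R[i] => complex.Im (z - w)^-1).
Proof.
under eq_fun do rewrite inv_complexE /=.
apply: measurable_funN; apply: measurable_funM.
  apply: continuous_measurable_complex.
  apply: (continuous_lipschitz_normc ltr01) => u w; rewrite mul1r.
  by move: z u w => [a b] [a1 b1] [a2 b2]; rewrite /= [X in Num.norm X](_ : _ = b2 - b1); [exact: (le_Im_normc ((a2 - a1) +i* (b2 - b1)))|ring].
apply: measurable_inv_ge0; last by move=> w; exact: sqr_ge0.
apply: measurable_funX; under eq_fun do rewrite normcBC.
exact: (continuous_measurable_complex (@continuous_normcB z)).
Qed.

Lemma measurable_set1_complex z : measurable [set z].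
Proof.
rewrite (_ : [set z] = (fun w => normc (w - z)) @^-1` [set 0]).
  rewrite -[X in measurable X]setTI.
  by apply: (continuous_measurable_complex (@continuous_normcB z)).
apply/seteqP; split => w /=; first by move=> ->; rewrite subrr normc0.
by move=> /eq0_normc/eqP; rewrite subr_eq0 => /eqP.
Qed.

End complex_topology.

(** * Anticoncentration of the logarithmic derivative *)

Section anticoncentration_general.
Context d (T : measurableType d) (R : realType) (P : probability T R).
Context d' (T' : measurableType d') (mu : probability T' R).
Variable X : nat -> {RV P >-> T'}.
Hypothesis X_indep : mutually_independent X.
Hypothesis X_distr : identically_distributed X mu.

Lemma negligible_RV (N : set T') j : mu.-negligible N -> P.-negligible (X j @^-1` N).
Proof.
move=> [A [mA A0 NA]]; exists (X j @^-1` A); split => //.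
- by rewrite -[X in measurable X]setTI; exact: measurable_funPT.
- by rewrite (preimage_RV X_distr).
- by move=> w /=; exact: NA.
Qed.

Lemma small_events_negligible (A : nat -> set T) :
  (forall n, P.-negligible (A n)) -> small_events P A.
Proof.
move=> A0 e e0; apply: nearW => n; have [B [mB B0 AB]] := A0 n.
by exists B; split => //; rewrite B0 lee_fin ltW.
Qed.

Lemma ae_all_RV (Q : T' -> Prop) : {ae mu, forall x, Q x} ->
  {ae P, forall w, forall j, Q (X j w)}.
Proof. by move=> aeQ; apply: ae_foralln => j; exact: (negligible_RV j aeQ). Qed.

(** If f is almost surely a constant a, its characteristic function has modulus 1 and gives nothing;
    but then a is nonzero and the sums have modulus n |a| almost surely, beyond |a| / 2 for n >= 1.
    Otherwise [chf_lt1] applies. *)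
Lemma psum_anticoncentration (f : T' -> R) : measurable_fun setT f ->
  ~ {ae mu, forall x, f x = 0} ->
  exists2 e, 0 < e & small_events P (fun n => [set w | `|psum X f n w| <= e]).
Proof.
move=> mf f0; have [[a fa]|nc] := pselect (exists a, {ae mu, forall x, f x = a}).
  have a0 : a != 0 by apply: contra_notN f0 => /eqP <-.
  exists (`|a| / 2); first by rewrite divr_gt0// normr_gt0.
  apply: (@small_events_sub _ _ _ _ _ (fun=> ~` [set w | forall j, f (X j w) = a])).
    exists 1%N => // n /= n1 w /= wn fX; move: wn; rewrite /psum.
    rewrite (eq_bigr (fun=> a)) => [|j _]; last exact: fX.
    rewrite sumr_const card_ord normrMn leNgt => /negP; apply.
    apply: (@lt_le_trans _ _ `|a|); last by rewrite -mulr_natr ler_peMr ?ler1n.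
    by rewrite ltr_pdivrMr// ltr_pMr ?ltr1n// normr_gt0.
  apply: small_events_negligible => _.
  exact: (@ae_all_RV (fun x => f x = a)).
have [T0 T00 chf1] := chf_lt1 mf nc.
exists T0^-1; first by rewrite invr_gt0.
exact: (psum_anticoncentration_nondeg X_indep X_distr mf T00 chf1).
Qed.

End anticoncentration_general.

Section cauchy_anticoncentration.
Context d (T : measurableType d) (R : realType) (P : probability T R).
Variables (mu : probability R[i] R) (X : nat -> {RV P >-> R[i]}).
Hypothesis X_indep : mutually_independent X.
Hypothesis X_distr : identically_distributed X mu.

Definition sample n w := [seq X j w | j <- iota 0 n].

Lemma size_sample n w : size (sample n w) = n.
Proof. by rewrite size_map size_iota. Qed.

Lemma sum_sample (V : nmodType) n w (f : R[i] -> V) :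
  \sum_(x <- sample n w) f x = \sum_(j < n) f (X j w).
Proof. by rewrite /sample big_map -[X in iota _ X](subn0 n) big_mkord. Qed.

(** The modulus dominates the real and the imaginary part, which are sums of i.i.d. real variables.
    If the summands of both vanished almost surely, so would the inverse of z - X; only 0 has
    inverse 0, so X would equal z almost surely although z is not an atom. *)
Lemma cauchy_anticoncentration z : mu [set z] = 0%E ->
  exists2 e, 0 < e &
    small_events P (fun n => [set w | normc (cauchy (sample n w) z) <= e]).
Proof.
move=> mz.
have Re_sum n w : complex.Re (cauchy (sample n w) z) =
    psum X (fun x => complex.Re (z - x)^-1) n w.
  rewrite /cauchy sum_sample /psum; apply: (big_morph (@complex.Re R)) => //.
  by move=> [? ?] [].
have Im_sum n w : complex.Im (cauchy (sample n w) z) =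
    psum X (fun x => complex.Im (z - x)^-1) n w.
  rewrite /cauchy sum_sample /psum; apply: (big_morph (@complex.Im R)) => //.
  by move=> [? ?] [].
have [re0|nre0] := pselect {ae mu, forall x, complex.Re (z - x)^-1 = 0}; last first.
  have [e e0 h] := psum_anticoncentration X_indep X_distr (measurable_Re_inv z) nre0.
  exists e => //; apply: small_events_sub h; apply: nearW => n w /=.
  by rewrite -Re_sum; apply: le_trans; exact: le_Re_normc.
have [im0|nim0] := pselect {ae mu, forall x, complex.Im (z - x)^-1 = 0}; last first.
  have [e e0 h] := psum_anticoncentration X_indep X_distr (measurable_Im_inv z) nim0.
  exists e => //; apply: small_events_sub h; apply: nearW => n w /=.
  by rewrite -Im_sum; apply: le_trans; exact: le_Im_normc.
exfalso.
have : {ae mu, forall x, x = z}.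
  apply: filterS2 re0 im0 => x rx ix; apply/eqP; rewrite eq_sym -subr_eq0 -invr_eq0.
  by move: rx ix; case: (_^-1) => a b /= -> ->.
move=> [A [mA A0 Az]].
have : (mu (A `|` [set z]) <= 0)%E.
  have e0 : (mu A + mu [set z] = 0)%E by rewrite A0 mz adde0.
  by rewrite -e0; exact: (measureU2 mu mA (measurable_set1_complex z)).
have -> : A `|` [set z] = setT.
  apply/seteqP; split => // x _; have [->|xz] := pselect (x = z); first by right.
  by left; exact: Az.
by rewrite probability_setT lee_fin ler10.
Qed.

End cauchy_anticoncentration.

(** * Comparison of the logarithmic potentials *)

Section good_radius.
Context d (T : measurableType d) (R : realType) (mu : probability T R).

Definition dyad (k : nat) : R := 1 / (2 ^ k.+1)%:R.

(* This dominates [- ln t], up to 1, and has integral at most 1 over t >= 0. *)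
Definition hlog (t : R) : \bar R := (\sum_(k <oo) ((t <= dyad k)%R%:R)%:E)%E.

Lemma dyad_gt0 k : 0 < dyad k.
Proof. by rewrite divr_gt0// ltr0n expn_gt0. Qed.

Lemma hlog_ge0 t : (0 <= hlog t)%E.
Proof. by apply: nneseries_ge0 => k _ _; rewrite lee_fin. Qed.

(** For the least n with 2^-n < t, the first n - 1 thresholds are all at least t, while - ln t is at
    most n ln 2 <= n. *)
Lemma ln_le_hlog t : 0 < t -> ((- ln t)%:E <= 1 + hlog t)%E.
Proof.
move=> t0.
have ex : exists n : nat, (2 ^ n)%:R^-1 < t.
  exists (Num.truncn t^-1).+1; rewrite invf_plt ?posrE// ?ltr0n ?expn_gt0//.
  apply: lt_trans (truncnS_gt _) _; rewrite ltr_nat; exact: ltn_expl.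
have [n nt nmin] := ex_minnP ex.
have ge_n : (n.-1%:R%:E <= hlog t)%E.
  rewrite /hlog; apply: (@le_trans _ _ (\sum_(0 <= k < n.-1) ((t <= dyad k)%R%:R)%:E)%E); last first.
    by apply: nneseries_lim_ge => k _ _; rewrite lee_fin.
  rewrite (eq_big_nat _ _ (F2 := fun=> 1%E)).
    by rewrite sumEFin lee_fin big_const_nat subn0 iter_addr_0.
  move=> k /andP[_ kn]; suff -> : t <= dyad k by [].
  rewrite leNgt; apply/negP; rewrite /dyad div1r => /nmin.
  by rewrite leqNgt; case: (n) kn => //= m; rewrite ltnS => ->.
apply: (@le_trans _ _ (1 + n.-1%:R%:E)%E); last exact: leeD2l.
rewrite -EFinD lee_fin.
have nn : n%:R <= 1 + n.-1%:R :> R by rewrite nat1r ler_nat leqSpred.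
apply: le_trans nn.
have p0 : 0 < (2 ^ n)%:R^-1 :> R by rewrite invr_gt0 ltr0n expn_gt0.
rewrite lerNl; apply: (@le_trans _ _ (ln (2 ^ n)%:R^-1)); last first.
  by rewrite ler_ln ?posrE// ltW.
rewrite lnV ?posrE ?ltr0n ?expn_gt0// lerN2 natrX lnXn//.
rewrite -(mulr_natl (ln _)) -[leRHS]mulr1 ler_wpM2l//.
by have := @le_ln1Dx R 1; rewrite -[1 + 1]/2; apply; rewrite (lt_trans _ ltr01)// ltrN10.
Qed.

Variables (Y : T -> R) (a b : R).
Hypotheses (mY : measurable_fun setT Y) (ab : a < b).

Let A k : set (measurableTypeR R * T) :=
  [set z | a <= z.1 <= b /\ `|Y z.2 - z.1| <= dyad k].

Let mA k : measurable (A k).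
Proof.
have m1 : measurable_fun setT (fun z : measurableTypeR R * T => z.1 : R).
  exact: measurable_fst.
have m2 : measurable_fun setT (fun z : measurableTypeR R * T => `|Y z.2 - z.1|).
  apply: measurableT_comp => //; apply: measurable_funB => //.
  by apply: measurableT_comp => //; exact: measurable_snd.
rewrite (_ : A k = ((fun z => z.1) @^-1` `[a, b]) `&`
   ((fun z => `|Y z.2 - z.1|) @^-1` `]-oo, dyad k])); last first.
  by apply/seteqP; split => z /=; rewrite !in_itv.
by apply: measurableI; rewrite -[X in measurable X]setTI; [exact: m1|exact: m2].
Qed.

Let F (z : measurableTypeR R * T) : \bar R := (\sum_(k <oo) (\1_(A k) z)%:E)%E.

Let mF : measurable_fun setT F.
Proof.
by apply: ge0_emeasurable_sum => [k x _ _|k _]; [rewrite lee_fin|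
  apply/measurable_EFinP; exact: measurable_indic].
Qed.

Let F0 z : (0 <= F z)%E.
Proof. by apply: nneseries_ge0 => k _ _; rewrite lee_fin. Qed.

Let F_in r w : a <= r <= b -> F (r, w) = hlog `|Y w - r|.
Proof.
move=> rab; apply: eq_eseriesr => k _; rewrite indicE; congr ((nat_of_bool _)%:R%:E).
by apply/idP/idP => [/set_mem[]//|h]; apply/mem_set.
Qed.

(** Tonelli: for fixed w the k-th set of radii lies in an interval of length [2 * dyad k], so
    integrating over r first gives at most 2. Were the integral over w infinite for every r in
    [a, b], the double integral would be infinite, as b - a > 0. *)
Lemma exists_radius : exists2 r, a <= r <= b & (\int[mu]_w hlog (`|Y w - r|)%R < +oo)%E.
Proof.
apply: contrapT => nr.
have infty r : a <= r <= b -> (\int[mu]_w F (r, w) = +oo)%E.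
  move=> rab; apply/eqP; rewrite -leye_eq leNgt; apply/negP => h; apply: nr.
  exists r => //; apply: le_lt_trans h.
  by under eq_integral do rewrite -F_in//.
pose L := @lebesgue_measure R.
have tonelli : (\int[L]_r \int[mu]_w F (r, w) = \int[mu]_w \int[L]_r F (r, w))%E.
  exact: (fubini_tonelli F mF F0).
have upper : (\int[mu]_w \int[L]_r F (r, w) <= 2%:E)%E.
  rewrite -[leRHS](_ : (\int[mu]_w 2%:E)%E = _); last first.
    by rewrite integral_cst//= probability_setT mule1.
  apply: ge0_le_integral => //.
  - by move=> w _; exact: integral_ge0.
  - exact: (measurable_fun_fubini_tonelli_G F mF F0).
  move=> w _.
  have mAw k : measurable_fun setT (fun r : measurableTypeR R => (\1_(A k) (r, w) : R)).
    exact: (measurableT_comp (measurable_indic (mA k)) (pair2_measurable w)).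
  rewrite /F integral_nneseries//; last first.
    by move=> k; apply/measurable_EFinP; exact: mAw.
  apply: le_trans (epsilon_trick0 xpredT (ler0n R 2)).
  apply: lee_nneseries => [k _ _|k _]; first exact: integral_ge0.
  apply: (@le_trans _ _ (\int[L]_r (\1_(`[Y w - dyad k, Y w + dyad k]) r)%:E)%E).
    apply: ge0_le_integral => //.
    - by apply/measurable_EFinP; exact: mAw.
    - by apply/measurable_EFinP; exact: measurable_indic.
    move=> r _; rewrite lee_fin !indicE ler_nat.
    case: (boolP ((r, w) \in A k)) => //= /set_mem[_ /= h].
    rewrite mem_set//= in_itv/=.
    by move: h; rewrite ler_norml => /andP[h1 h2]; apply/andP; split; lra.
  rewrite integral_indic// setIT /L/= lebesgue_measure_itv/= lte_fin.
  rewrite ltrD2l gtrN ?dyad_gt0//= -EFinB lee_fin opprB addrA.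
  rewrite [X in X <= _](_ : _ = 2 * dyad k); last by ring.
  by rewrite /dyad; lra.
have lower : (\int[L]_r \int[mu]_w F (r, w) = +oo)%E.
  apply/eqP; rewrite -leye_eq.
  apply: (@le_trans _ _ (\int[L]_(r in `[a, b]) \int[mu]_w F (r, w))%E); last first.
    apply: ge0_subset_integral => //.
    - exact: (measurable_fun_fubini_tonelli_F F mF F0).
    - by move=> r _; exact: integral_ge0.
  rewrite (eq_integral (cst +oo%E)); last first.
    by move=> r; rewrite inE/= in_itv/= => /infty.
  rewrite integral_cst// /L/= lebesgue_measure_itv/= lte_fin ab -EFinB mulyr.
  by rewrite gtr0_sg ?subr_gt0// mul1e.
by move: upper; rewrite -tonelli lower.
Qed.

End good_radius.

Section far_gap.
Variable R : realType.

Lemma ln_near_le (e K : R) : 0 < e ->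
  \forall n \near \oo, ln n%:R + K <= e * n%:R.
Proof.
move=> e0; pose a := e / 2; have a0 : 0 < a by rewrite divr_gt0.
near=> n.
have n0 : 0 < n%:R :> R by rewrite ltr0n; near: n; exists 1%N.
have h1 : ln (a * n%:R) <= a * n%:R by apply/ltW/ln_sublinear; rewrite mulr_gt0.
rewrite lnM ?posrE// in h1.
have h2 : (K - ln a) / a < n%:R by near: n; exact: nbhs_infty_gtr.
rewrite ltr_pdivrMr// in h2.
have -> : e = a + a by rewrite /a -splitr.
by rewrite mulrDl; lra.
Unshelve. all: by end_near. Qed.

Definition ehlog c r w : \bar R := hlog (gap c r w).

Lemma measurable_gap c r : measurable_fun setT ((gap c r : R[i] -> R)).
Proof.
apply: measurableT_comp => //; apply: measurable_funB => //.
exact: (continuous_measurable_complex (@continuous_normcB _ c)).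
Qed.

Lemma measurable_ehlog c r : measurable_fun setT (ehlog c r).
Proof.
apply: ge0_emeasurable_sum => [k x _ _|k _]; first by rewrite lee_fin.
apply/measurable_EFinP.
rewrite (_ : (fun _ => _) = (\1_(`]-oo, dyad R k]) : R -> R) \o gap c r).
  by apply: measurableT_comp; [exact: measurable_indic|exact: measurable_gap].
apply/funext => w /=; rewrite indicE; congr ((nat_of_bool _)%:R).
by apply/idP/idP => [h|/set_mem]; [apply/mem_set|]; rewrite /= in_itv.
Qed.

(** When |w - c| >= 2 r, [far] is at most twice [gap], so the growth at infinity cancels. Otherwise
    [far] is at most 2 r and only [- ln (gap c r w)] can be large, which [hlog] dominates. *)
Lemma ln_far_gap_le c r w : 0 < r -> 0 < gap c r w ->
  ((ln (far c r w) - ln (gap c r w))%:E <= (2 + `|ln (2 * r)|)%:E + ehlog c r w)%E.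
Proof.
move=> r0 g0; have f0 := far_gt0 c w r0.
have [h|h] := leP (2 * r) (normc (w - c)).
  apply: (@le_trans _ _ 1%:E).
    rewrite lee_fin -ln_div ?posrE//.
    apply: (@le_trans _ _ (ln 2)); last first.
      by have := @le_ln1Dx R 1; rewrite -[1 + 1]/2; apply; lra.
    rewrite ler_ln ?posrE ?divr_gt0// ler_pdivrMr// /far /gap.
    rewrite ger0_norm; last lra.
    by rewrite ge_max; apply/andP; split; lra.
  rewrite -[leLHS]adde0; apply: leeD; last exact: hlog_ge0.
  by rewrite lee_fin; have := normr_ge0 (ln (2 * r)); lra.
have lf : ln (far c r w) <= `|ln (2 * r)|.
  apply: le_trans (ler_norm _); rewrite ler_ln ?posrE ?mulr_gt0//.
  by rewrite /far ge_max (ltW h) andbT; lra.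
apply: (@le_trans _ _ (`|ln (2 * r)|%:E + (- ln (gap c r w))%:E)%E).
  by rewrite -EFinD lee_fin lerD2r.
apply: (@le_trans _ _ (`|ln (2 * r)|%:E + (1 + ehlog c r w))%E).
  by rewrite leeD2l//; exact: ln_le_hlog.
rewrite addeA; apply: leeD => //; rewrite -EFinD lee_fin; lra.
Qed.

End far_gap.

Section potential_comparison.
Context d (T : measurableType d) (R : realType) (P : probability T R).
Variables (mu : probability R[i] R) (X : nat -> {RV P >-> R[i]}).
Hypothesis X_indep : mutually_independent X.
Hypothesis X_distr : identically_distributed X mu.

Lemma lnfar_upper c r e : 0 < r -> 0 < e -> \forall n \near \oo, forall w,
  lnfar c r (crit (sample X n w)) <= lnfar c r (sample X n w) + e * n%:R.
Proof.
(* Then (r + a) / r = 1 + e / 2, whose logarithm costs at most e / 2 per point; the other half of e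
   absorbs the term logarithmic in n. *)
move=> r0 e0; pose a := e / 2 * r.
have e20 : 0 < e / 2 by rewrite divr_gt0.
have a0 : 0 < a by rewrite mulr_gt0.
near=> n => w.
have n1 : (0 < n)%N by near: n; exists 1%N.
have n0 : 0 < n%:R :> R by rewrite ltr0n.
have sn : size (sample X n w) = n.-1.+1 by rewrite size_sample prednK.
apply: le_trans (lnfar_crit_upper c sn r0 a0) _; rewrite prednK//.
have -> : e * n%:R = e / 2 * n%:R + e / 2 * n%:R by rewrite -mulrDl -splitr.
rewrite -addrA lerD2l lerD//.
  rewrite mulrC ler_wpM2r ?(ltW n0)//.
  have -> : (r + a) / r = 1 + e / 2 by rewrite /a; field; rewrite gt_eqF.
  by apply: le_ln1Dx; lra.
have -> : 4 * n%:R / a = n%:R * (4 / a) by field; rewrite gt_eqF.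
rewrite lnM ?posrE ?divr_gt0//.
by near: n; exact: ln_near_le.
Unshelve. all: by end_near. Qed.

End potential_comparison.

Section potential_lower.
Context d (T : measurableType d) (R : realType) (P : probability T R).
Variables (mu : probability R[i] R) (X : nat -> {RV P >-> R[i]}).
Hypothesis X_indep : mutually_independent X.
Hypothesis X_distr : identically_distributed X mu.

Lemma hlog0 : hlog 0 = +oo%E :> \bar R.
Proof.
apply/eqyP => a a0; apply: (@le_trans _ _ (\sum_(0 <= k < (Num.truncn a).+1) ((0 <= dyad R k)%R%:R)%:E)%E); last first.
  by apply: nneseries_lim_ge => k _ _; rewrite lee_fin.
rewrite (eq_bigr (fun=> 1%E)).
  rewrite sumEFin lee_fin big_const_nat subn0 iter_addr_0.
  by apply/ltW; exact: truncnS_gt.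
by move=> k _; rewrite (ltW (dyad_gt0 R k)).
Qed.

(** [hlog] is infinite at 0, so its integrability forbids mass on the circle. Hence the sample
    almost surely avoids the circle, and no point of the circle is an atom, as anticoncentration
    requires. *)
Lemma gap_eq0_ae c r : (\int[mu]_w ehlog c r w < +oo)%E ->
  {ae mu, forall w, gap c r w != 0}.
Proof.
move=> Ifin.
have iE : mu.-integrable setT (ehlog c r).
  apply/integrableP; split; first exact: measurable_ehlog.
  by under eq_integral do rewrite gee0_abs ?hlog_ge0//.
apply: filterS (integrable_ae measurableT iE) => w /(_ I) h.
by apply/eqP => g0; move: h; rewrite /ehlog g0 hlog0.
Qed.

Lemma small_events_uniform (I : eqType) (A : I -> R -> nat -> set T) (s : seq I) :
  (forall z e e' n, e <= e' -> A z e n `<=` A z e' n) ->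
  {in s, forall z, exists2 e, 0 < e & small_events P (A z e)} ->
  exists2 e, 0 < e & {in s, forall z, small_events P (A z e)}.
Proof.
move=> Amono; elim: s => [|z s IH] h; first by exists 1.
have [e e0 se] := IH (fun y ys => h y (mem_behead (s := z :: s) ys)).
have [e' e'0 se'] := h z (mem_head _ _).
exists (Num.min e e'); first by rewrite lt_min e0.
move=> y; rewrite in_cons => /orP[/eqP->|ys].
  by apply: small_events_sub se'; apply: nearW => n; apply: Amono; rewrite ge_min lexx orbT.
by apply: small_events_sub (se y ys); apply: nearW => n; apply: Amono; rewrite ge_min lexx.
Qed.

(** [H] is only integrable, so the first moment is used. The bound is uniform in n without vanishing
    as n grows; it becomes small through a large a, which is where the number of test points
    enters. *)
Lemma markov_sum (H : R[i] -> \bar R) (n : nat) (a K : R) :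
  measurable_fun setT H -> (forall w, 0 <= H w)%E -> (\int[mu]_w H w <= K%:E)%E ->
  0 < a -> (0 < n)%N ->
  measurable [set w | (a * n%:R)%:E <= \sum_(j < n) H (X j w)]%E /\
  (P [set w | (a * n%:R)%:E <= \sum_(j < n) H (X j w)]%E <= (K / a)%:E)%E.
Proof.
move=> mH H0 HK a0 n0; pose S w := (\sum_(j < n) H (X j w))%E.
have nR : 0 < n%:R :> R by rewrite ltr0n.
have mHX j : measurable_fun setT (fun w => H (X j w)).
  by apply: measurableT_comp => //; exact: measurable_funPT.
have mS : measurable_fun setT S by apply: emeasurable_sum => j; exact: mHX.
have S0 w : (0 <= S w)%E by apply: sume_ge0 => j _; exact: H0.
have IS : (\int[P]_w S w <= (n%:R * K)%:E)%E.
  rewrite /S ge0_integral_sum//.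
  rewrite [leRHS](_ : _ = \sum_(j < n) K%:E)%E; last first.
    by rewrite sumEFin sumr_const card_ord mulr_natl.
  apply: lee_sum => j _; apply: le_trans HK.
  rewrite -(ge0_integral_distribution (X j) mH H0).
  rewrite (eq_measure_integral mu)// => A mA _; exact: X_distr.
have SA : [set w | (a * n%:R)%:E <= S w]%E =
    setT `&` [set w | (a * n%:R)%:E <= `|S w|]%E.
  by rewrite setTI; apply/seteqP; split => w /=; rewrite gee0_abs.
split; first by rewrite SA; apply: emeasurable_fun_c_infty => //; exact: measurableT_comp.
have an0 : 0 < a * n%:R by rewrite mulr_gt0.
have := le_integral_abse P measurableT mS an0; rewrite -SA => h.
have : ((a * n%:R)%:E * P [set w | (a * n%:R)%:E <= S w] <= (n%:R * K)%:E)%E.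
  apply: le_trans h (le_trans _ IS); under eq_integral do rewrite gee0_abs//.
  exact: lexx.
have PA : P [set w | (a * n%:R)%:E <= S w]%E \is a fin_num.
  rewrite fin_num_measure// SA.
  by apply: emeasurable_fun_c_infty => //; exact: measurableT_comp.
rewrite -(fineK PA) -EFinM !lee_fin => {}h.
rewrite ler_pdivlMr// -(ler_pM2l nR); apply: le_trans h.
by rewrite le_eqVlt; apply/orP; left; apply/eqP; ring.
Qed.

Lemma lnfar_lower c r e : 0 < r -> 0 < e -> (\int[mu]_w ehlog c r w < +oo)%E ->
  small_events P (fun n => [set w |
    lnfar c r (crit (sample X n w)) < lnfar c r (sample X n w) - e * n%:R]).
Proof.
move=> r0 e0 Ifin t t0.
pose C := 2 + `|ln (2 * r)|; pose H w := (C%:E + ehlog c r w)%E.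
have C0 : 0 <= C by rewrite addr_ge0.
have H0 w : (0 <= H w)%E by rewrite adde_ge0 ?lee_fin ?hlog_ge0.
have mH : measurable_fun setT H.
  by apply: emeasurable_funD => //; exact: measurable_ehlog.
have Ifin' : (\int[mu]_w ehlog c r w)%E \is a fin_num.
  rewrite ge0_fin_numE//; apply: integral_ge0 => w _; exact: hlog_ge0.
pose K := C + fine (\int[mu]_w ehlog c r w)%E.
have HK : (\int[mu]_w H w <= K%:E)%E.
  have -> : K%:E = (C%:E + \int[mu]_w ehlog c r w)%E by rewrite /K EFinD fineK.
  rewrite /H ge0_integralD//; last 2 first.
  - by move=> w _; exact: hlog_ge0.
  - exact: measurable_ehlog.
  by rewrite integral_cst//= probability_setT mule1.
pose e3 := e / 3; have e30 : 0 < e3 by rewrite divr_gt0.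
(* The first summand makes the loss (n / N) ln 2 at most [e3 * n]; the second makes the Markov bound
   K / (e3 N) at most t / 2. *)
pose N := (Num.truncn (1 / e3 + 2 * K / (e3 * t))).+1.
have K0 : 0 <= K by rewrite addr_ge0// fine_ge0// integral_ge0// => w _; exact: hlog_ge0.
have NR : 0 < N%:R :> R by rewrite ltr0n.
have t20 : 0 < t / 2 by rewrite divr_gt0.
have Nbig : 1 / e3 + 2 * K / (e3 * t) < N%:R by exact: truncnS_gt.
have q1 : 0 <= 1 / e3 by rewrite divr_ge0// ltW.
have q2 : 0 <= 2 * K / (e3 * t) by apply: divr_ge0; rewrite mulr_ge0 ?(ltW e30) ?(ltW t0).
have N1 : 1 / N%:R <= e3.
  by rewrite ler_pdivrMr// mulrC -ler_pdivrMr//; lra.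
have N2 : K / (e3 * N%:R) <= t / 2.
  rewrite ler_pdivrMr ?mulr_gt0//.
  have h : 2 * K / (e3 * t) < N%:R by lra.
  rewrite ltr_pdivrMr ?mulr_gt0// in h.
  rewrite (_ : t / 2 * (e3 * N%:R) = N%:R * (e3 * t) / 2); last by field.
  by rewrite ler_pdivlMr// mulrC ltW.
have [p [pN pc] pw] := @circle_points R c r N r0 isT.
have aeg := gap_eq0_ae Ifin.
have mz z : z \in p -> mu [set z] = 0%E.
  move=> zp; case: aeg => A [mA A0 Ag].
  apply/eqP; rewrite eq_le measure_ge0 andbT -A0 le_measure ?inE//.
    exact: measurable_set1_complex.
  by move=> w /= ->; apply: Ag => /=; rewrite /gap (pc _ zp) subrr normr0 eqxx.
pose A z a n := [set w | normc (cauchy (sample X n w) z) <= a].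
have [a a0 Ap] : exists2 a, 0 < a & {in p, forall z, small_events P (A z a)}.
  apply: small_events_uniform.
    by move=> z a a' n aa' w /= wa; exact: le_trans aa'.
  by move=> z /mz; exact: cauchy_anticoncentration.
have sA := small_events_bigcup Ap t20.
have [B0 [mB0 PB0 B0g]] := ae_all_RV X_distr aeg.
near=> n.
have n0 : (0 < n)%N by near: n; exists 1%N.
have [B1 [mB1 AB1 PB1]] : exists B, [/\ measurable B,
    \bigcup_(z in [set` p]) A z a n `<=` B & (P B <= (t / 2)%:E)%E].
  by near: n; exact: sA.
have [mB2 PB2] := markov_sum mH H0 HK (mulr_gt0 e30 NR) n0.
set B2 := (X in measurable X) in mB2 PB2.
(* [B0] is null and covers the event that some X_j lies on the circle, [B1] the event that |L_n| <=
   a at some test point; on [B2] the majorant [H] of the Jensen errors has a large sum. Off the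
   three sets each error in [lnfar_crit_lower] is at most e n / 3. *)
exists (B0 `|` (B1 `|` B2)); split.
- by apply: measurableU => //; exact: measurableU.
- move=> w /= wlt.
  have [wB0|wB0] := pselect (B0 w); first by left.
  have [wB1|wB1] := pselect (B1 w); first by right; left.
  right; right; rewrite /B2/= leNgt; apply/negP => wS.
  have gX j : gap c r (X j w) != 0.
    by apply: contrapT => gj; apply: wB0; apply: B0g => /= /(_ j).
  have sn : size (sample X n w) = n.-1.+1 by rewrite size_sample prednK.
  have sg : {in sample X n w, forall x, 0 < gap c r x}.
    by move=> _ /mapP[j _ ->]; rewrite lt_def gX gap_ge0.
  have pa : {in p, forall z, a <= normc (cauchy (sample X n w) z)}.
    move=> z zp; rewrite leNgt; apply/negP => za; apply: wB1; apply: AB1.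
    by exists z => //=; exact: ltW.
  have p0 : (0 < size p)%N by rewrite pN.
  have := @lnfar_crit_lower R c r a _ _ p sn r0 a0 p0 pc.
  rewrite pN => /(_ pw sg pa); apply/negP; rewrite -ltNge.
  apply: lt_le_trans wlt _.
  have SG : \sum_(x <- sample X n w) (ln (far c r x) - ln (gap c r x)) <= e3 * N%:R * n%:R.
    rewrite -lee_fin; apply: le_trans (ltW wS).
    rewrite sum_sample -sumEFin; apply: lee_sum => j _.
    by apply: ln_far_gap_le => //; rewrite lt_def gX gap_ge0.
  set S := \sum_(x <- _) _ in SG *; rewrite prednK//.
  have nR : 0 < n%:R :> R by rewrite ltr0n.
  have S1 : N%:R^-1 * S <= e3 * n%:R by rewrite mulrC ler_pdivrMr// mulrAC.
  have S2 : n.-1%:R / N%:R * ln 2 <= e3 * n%:R :> R.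
    have ln21 : ln 2 <= 1 :> R.
      by have := @le_ln1Dx R 1; rewrite -[1 + 1]/2; apply; lra.
    apply: (@le_trans _ _ (n.-1%:R / N%:R * 1)); first by rewrite ler_wpM2l ?divr_ge0.
    rewrite mulr1 ler_pdivrMr// mulrAC (le_trans (_ : _ <= 1 * n%:R))//.
      by rewrite mul1r ler_nat leq_pred.
    by rewrite ler_wpM2r ?(ltW nR)// -ler_pdivrMr.
  have S3 : ln n%:R + - ln a <= e3 * n%:R by near: n; exact: ln_near_le.
  have -> : e * n%:R = e3 * n%:R + e3 * n%:R + e3 * n%:R by rewrite /e3; field.
  by clear - S1 S2 S3; lra.
- have PB12 : (P (B1 `|` B2) <= t%:E)%E.
    apply: le_trans (measureU2 P mB1 mB2) _; rewrite [t]splitr EFinD.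
    apply: leeD => //; apply: le_trans PB2 _.
    by rewrite lee_fin.
  have h : (P B0 + P (B1 `|` B2) <= t%:E)%E by rewrite PB0 add0e.
  by apply: le_trans h; exact: (measureU2 P mB0 (measurableU _ _ mB1 mB2)).
Unshelve. all: by end_near. Qed.

(** An arbitrary r is reached from a good radius q slightly below it: from q to r the sum over the
    critical points can only increase, and the sum over the sample increases by at most n ln (r /
    q). *)
Lemma lnfar_convergence c r e : 0 < r -> 0 < e ->
  small_events P (fun n => [set w |
    e * n%:R <= `|lnfar c r (crit (sample X n w)) - lnfar c r (sample X n w)| ]).
Proof.
move=> r0 e0; pose a := e / 3.
have a0 : 0 < a by rewrite divr_gt0.
(* a1 <= 1/2 gives 1 / (1 - a1) <= 1 + 2 a1, and a1 <= a / 2 then gives ln (r / q) <= a. *)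
pose a1 := Num.min (a / 2) 2^-1; have a10 : 0 < a1 by rewrite lt_min divr_gt0//= invr_gt0.
have a11 : a1 <= 2^-1 by rewrite /a1 ge_min lexx orbT.
have a1a : a1 <= a / 2 by rewrite /a1 ge_min lexx.
have rlt : r * (1 - a1) < r by rewrite gtr_pMr//; lra.
have mY : measurable_fun setT (fun w : R[i] => normc (w - c)).
  exact: (continuous_measurable_complex (@continuous_normcB _ c)).
have [q /andP[q1 q2] Iq] := exists_radius mu mY rlt.
have q0 : 0 < q by apply: lt_le_trans q1; rewrite mulr_gt0//; lra.
have := lnfar_lower q0 a0 Iq; apply: small_events_sub.
have ln_rq : ln (r / q) <= a.
  have rq : r / q <= 1 + 2 * a1.
    rewrite ler_pdivrMr//.
    apply: (@le_trans _ _ ((1 + 2 * a1) * (r * (1 - a1)))); last first.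
      by rewrite ler_wpM2l//; lra.
    rewrite mulrCA ler_peMr ?(ltW r0)//.
    have : 0 <= a1 * (2^-1 - a1) by rewrite mulr_ge0 ?(ltW a10)// subr_ge0.
    by move=> ?; lra.
  apply: (@le_trans _ _ (ln (1 + 2 * a1))).
    by rewrite ler_ln ?posrE ?divr_gt0//; lra.
  by apply: le_trans (le_ln1Dx _) _; lra.
near=> n => w /=.
have up : lnfar c r (crit (sample X n w)) <= lnfar c r (sample X n w) + a * n%:R.
  by move: w; near: n; exact: lnfar_upper.
have n0 : 0 < n%:R :> R by rewrite ltr0n; near: n; exists 1%N.
have ea : e = a + a + a by rewrite /a; field.
have m1 := lnfar_le c (crit (sample X n w)) q0 q2.
have m2 := lnfar_dilate c (sample X n w) q0 q2.
rewrite size_sample in m2.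
have m3 : n%:R * ln (r / q) <= a * n%:R by rewrite mulrC ler_wpM2r// ltW.
have an0 : 0 < a * n%:R by rewrite mulr_gt0.
move=> eD; rewrite ltNge; apply/negP => lo; move: eD; apply/negP; rewrite -ltNge.
rewrite ea !mulrDl ltr_norml.
by apply/andP; split; lra.
Unshelve. all: by end_near. Qed.

End potential_lower.

(** * Approximation by differences of potentials *)

Section uniform_continuity.
Variable R : realType.

Lemma compact_square (M : R) :
  compact ((fun p : R * R => p.1 +i* p.2) @` (`[- M, M] `*` `[- M, M])).
Proof.
apply: continuous_compact; last by apply: compact_setX; exact: segment_compact.
apply: continuous_subspaceT => -[x y].
move=> A /nbhs_normc[e e0 eA].
have e20 : 0 < e / 2 by rewrite divr_gt0.
exists ([set x' | `|x - x'| < e / 2], [set y' | `|y - y'| < e / 2]).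
  by split; [exact: (nbhsx_ballx x)|exact: (nbhsx_ballx y)].
move=> [x' y'] [/= hx hy]; apply: eA.
apply: le_lt_trans (normc_le_ReIm _) _ => /=.
by rewrite distrC [X in _ + X]distrC [e]splitr; exact: ltrD.
Qed.

(** Only w is confined to the disc; v may leave it, because the centres of the bumps near the
    boundary do. *)
Lemma uniformly_continuous_disc (f : R[i] -> R) (M e : R) : continuous f -> 0 < e ->
  exists2 t, 0 < t & forall w v, normc w <= M -> normc (v - w) < t -> `|f w - f v| < e.
Proof.
move=> cf e0; have e20 : 0 < e / 2 by rewrite divr_gt0.
pose Q (t : R) (w : R[i]) := forall v, normc (v - w) < t -> `|f w - f v| < e.
have /compact_near_coveringP := @compact_square M.
move=> /(_ R (0^'+) Q (at_right_proper_filter (0 : R))).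
have hQ x : ((fun p : R * R => p.1 +i* p.2) @` (`[- M, M] `*` `[- M, M])) x ->
    \forall x' \near x & t \near 0^'+, Q t x'.
  move=> _.
  have : \forall w \near x, `|f x - f w| < e / 2.
    by have /cvgrPdist_lt := cf x; apply.
  move=> /nbhs_normc[s s0 xs].
  have s20 : 0 < s / 2 by rewrite divr_gt0.
  exists ([set w | normc (w - x) < s / 2], [set t | 0 < t < s / 2]).
    split; first exact: near_normc.
    near=> t; apply/andP; split => //; near: t; exact: nbhs_right_lt.
  move=> [w t] [/= wx /andP[t0 ts]] v vw.
  have fw : `|f x - f w| < e / 2.
    by apply: xs; apply: lt_le_trans wx _; lra.
  have fv : `|f x - f v| < e / 2.
    apply: xs; rewrite -(subrK w v) -addrA; apply: le_lt_trans (normcD _ _) _.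
    by rewrite [s]splitr; apply: ltrD => //; exact: lt_trans ts.
  rewrite -(subrK (f x) (f w)) -addrA; apply: le_lt_trans (ler_normD _ _) _.
  by rewrite distrC [e]splitr; exact: ltrD.
move=> /(_ hQ) nQ.
near (0 : R)^'+ => t; exists t => // w v wM vw.
have : Q t w; last by apply.
have : (fun p : R * R => p.1 +i* p.2) @` (`[- M, M] `*` `[- M, M]) `<=` Q t.
  by near: t; exact: nQ.
apply; exists (complex.Re w, complex.Im w); last by case: (w).
split; rewrite /= in_itv/= -ler_norml.
  by apply: le_trans (le_Re_normc _) wM.
by apply: le_trans (le_Im_normc _) wM.
Unshelve. all: by end_near. Qed.

End uniform_continuity.

Section tents.
Variable R : realType.
Implicit Types (w c : R[i]).

(** A cone in logarithmic scale: between the radii r and 2 r it equals ln (2 r / |w - c|). *)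
Definition tent c (r : R) w := ln (far c (2 * r) w) - ln (far c r w).

Lemma tent_ge0 c r w : 0 < r -> 0 <= tent c r w.
Proof.
move=> r0; rewrite subr_ge0 ler_ln ?posrE ?far_gt0 ?mulr_gt0//.
rewrite /far ge_max !le_max lexx orbT andbT; apply/orP; left; lra.
Qed.

Lemma tent_le c r w : 0 < r -> tent c r w <= ln 2.
Proof.
move=> r0; have r2 : r <= 2 * r by lra.
have := ln_far_dilate c w r0 r2.
by rewrite mulfK ?gt_eqF// /tent; lra.
Qed.

Lemma tent_near c r w : 0 < r -> normc (w - c) <= r -> tent c r w = ln 2.
Proof.
move=> r0 wr; rewrite /tent /far.
rewrite !max_l//; last by apply: le_trans wr _; lra.
by rewrite lnM ?posrE// addrK.
Qed.

Lemma tent_far c r w : 0 < r -> 2 * r <= normc (w - c) -> tent c r w = 0.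
Proof.
move=> r0 wr; rewrite /tent /far.
by rewrite !max_r ?subrr//; apply: le_trans wr; lra.
Qed.

Lemma far_lipschitz c r w v : `|far c r w - far c r v| <= normc (w - v).
Proof.
have h : `|normc (w - c) - normc (v - c)| <= normc (w - v).
  by apply: le_trans (normcB_abs _ _) _; rewrite opprB addrA subrK.
apply: le_trans h; rewrite /far; set a := normc _; set b := normc _.
by case: (leP r a) => ra; case: (leP r b) => rb; rewrite ?subrr ?normr0//;
  [rewrite !ger0_norm//; lra|rewrite distrC [leRHS]distrC !ger0_norm//; lra].
Qed.

Lemma continuous_ln_far c r : 0 < r -> continuous (fun w => ln (far c r w)).
Proof.
move=> r0; apply: (@continuous_lipschitz_normc _ _ r^-1); first by rewrite invr_gt0.
have half z w : ln (far c r z) - ln (far c r w) <= r^-1 * normc (w - z).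
  have fz := far_gt0 c z r0; have fw := far_gt0 c w r0.
  rewrite -ln_div ?posrE//.
  have -> : far c r z / far c r w = 1 + (far c r z - far c r w) / far c r w.
    by field; rewrite gt_eqF.
  apply: le_trans (le_ln1Dx _) _.
    by rewrite mulrBl divff ?gt_eqF// ltrBrDl addrN divr_gt0.
  apply: (@le_trans _ _ (normc (w - z) / far c r w)).
    rewrite ler_pM2r ?invr_gt0//; apply: le_trans (ler_norm _) _.
    by rewrite normcBC; exact: far_lipschitz.
  rewrite mulrC ler_wpM2r ?normc_ge0// lef_pV2 ?posrE//.
  by rewrite /far le_max lexx.
move=> z w; rewrite ler_norml half andbT lerNl opprB normcBC; exact: half.
Qed.

Lemma continuous_tent c r : 0 < r -> continuous (tent c r).
Proof.
move=> r0 w; have r20 : 0 < 2 * r by rewrite mulr_gt0.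
exact: (cvgB (@continuous_ln_far c _ r20 w) (@continuous_ln_far c _ r0 w)).
Qed.

(** An open interval of length 8 contains at most 8 integers: they lie among the 8 consecutive ones
    that start at the smallest. *)
Lemma count_near (t : R) (m : nat) :
  \sum_(a <- iota 0 m) ((`|t - a%:R| < 4)%R : nat)%:R <= 8 :> R.
Proof.
pose p (a : nat) := `|t - a%:R| < 4.
rewrite -natr_sum -[8]/(8%:R) ler_nat.
have -> : (\sum_(a <- iota 0 m) (p a : nat))%N = size (seq.filter p (iota 0 m)).
  by rewrite size_filter -sum1_count [RHS]big_mkcond/=; apply: eq_bigr => a _; case: (p a).
case E : (seq.filter p (iota 0 m)) => [//|a0 s]; rewrite -E.
have a0p : p a0 by have := mem_head a0 s; rewrite -E mem_filter => /andP[].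
have srt : sorted leq (a0 :: s).
  by rewrite -E; apply: sorted_filter; [exact: leq_trans|exact: iota_sorted].
rewrite -(size_iota a0 8); apply: uniq_leq_size; first by rewrite filter_uniq// iota_uniq.
move=> a ain; have : a \in a0 :: s by rewrite -E.
have ap : p a by move: ain; rewrite mem_filter => /andP[].
move=> ain'; have a0a : (a0 <= a)%N.
  move: ain'; rewrite in_cons => /orP[/eqP->//|as_].
  by have /allP/(_ _ as_) := order_path_min leq_trans srt.
rewrite mem_iota a0a/= -(ltr_nat R) natrD.
move: ap a0p; rewrite /p !ltr_norml => /andP[? ?] /andP[? ?]; lra.
Qed.

End tents.

Section approximation.
Variable R : realType.
Variable V : set (R[i] -> R).
Hypothesis VD : forall f g, V f -> V g -> V (fun w => f w + g w).
Hypothesis VZ : forall a f, V f -> V (fun w => a * f w).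
Hypothesis Vtent : forall c r, 0 < r -> V (tent c r).

Lemma span0 : V (fun=> 0).
Proof.
have -> : (fun=> 0) = (fun w => 0 * tent 0 1 w) :> (R[i] -> R).
  by apply/funext => w; rewrite mul0r.
exact/VZ/Vtent.
Qed.

Lemma span_sum I (s : seq I) (F : I -> R[i] -> R) : (forall i, V (F i)) ->
  V (fun w => \sum_(i <- s) F i w).
Proof.
move=> VF; elim: s => [|i s IH].
  by under eq_fun do rewrite big_nil; exact: span0.
by under eq_fun do rewrite big_cons; exact: VD.
Qed.

(* [F] is the sum of the [f c] times bumps centred at the points c of a fine
   square lattice, divided by 64 times the height of a bump: every point lies in
   the support of at most 64 bumps, and on top of at least one. *)
Lemma approximation_step (f : R[i] -> R) (B M : R) : continuous f -> 0 < B ->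
  (forall w, `|f w| <= B) ->
  exists F, [/\ V F, continuous F, forall w, `|F w| <= B &
    forall w, normc w <= M -> `|f w - F w| <= 127 / 128 * B].
Proof.
move=> cf B0 fB; have B128 : 0 < B / 128 by rewrite divr_gt0.
have [s s0 fs] := uniformly_continuous_disc M cf B128.
(* The lattice has step eta and coordinates from - Q to Q - 1. Rounding down moves a point of the
   disc by at most 2 eta, the radius of the plateau of a bump; the supports have radius 4 eta = s /
   2 < s. *)
pose eta := s / 8; have eta0 : 0 < eta by rewrite divr_gt0.
have eta2 : 0 < 2 * eta by rewrite mulr_gt0.
pose Q := (Num.truncn (`|M| / eta)).+1.
have MQ : `|M| / eta < Q%:R by exact: truncnS_gt.
pose ctr (p : 'I_(2 * Q) * 'I_(2 * Q)) : R[i] :=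
  (eta * (p.1%:R - Q%:R)) +i* (eta * (p.2%:R - Q%:R)).
pose h p w := tent (ctr p) (2 * eta) w.
have h0 p w : 0 <= h p w by exact: tent_ge0.
pose H w := \sum_p h p w.
have H0 w : 0 <= H w by apply: sumr_ge0.
have ln20 : 0 < ln 2 :> R by rewrite ln_gt0// ltr1n.
have hfar p w : h p w != 0 -> normc (w - ctr p) < 4 * eta.
  move=> hn; rewrite ltNge; apply: contra hn => far4.
  by rewrite /h tent_far// (le_trans _ far4)//; lra.
have hle p w : h p w <= ln 2 *
    (((`|complex.Re w / eta + Q%:R - p.1%:R| < 4)%R : nat)%:R *
     ((`|complex.Im w / eta + Q%:R - p.2%:R| < 4)%R : nat)%:R).
  have [->|hn] := eqVneq (h p w) 0; first by rewrite !mulr_ge0// ltW.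
  have wp := hfar _ _ hn.
  have scal (x a : R) : `|x - eta * (a - Q%:R)| < 4 * eta -> `|x / eta + Q%:R - a| < 4.
    move=> xa; have -> : x / eta + Q%:R - a = (x - eta * (a - Q%:R)) / eta.
      by field; rewrite gt_eqF.
    by rewrite normrM [X in _ * X]ger0_norm ?invr_ge0 ?(ltW eta0)// ltr_pdivrMr.
  rewrite !scal ?mulr1; first exact: tent_le.
    apply: le_lt_trans wp; case: w {hn} => x y.
    exact: (le_Im_normc ((x - eta * (p.1%:R - Q%:R)) +i* (y - eta * (p.2%:R - Q%:R)))).
  apply: le_lt_trans wp; case: w {hn} => x y.
  exact: (le_Re_normc ((x - eta * (p.1%:R - Q%:R)) +i* (y - eta * (p.2%:R - Q%:R)))).
have Hle w : H w <= 64 * ln 2.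
  apply: le_trans (ler_sum _ (fun p _ => hle p w)) _.
  rewrite -mulr_sumr mulrC ler_wpM2r ?(ltW ln20)//.
  rewrite -(pair_big xpredT xpredT (fun a b : 'I_(2 * Q) =>
    (((`|complex.Re w / eta + Q%:R - a%:R| < 4)%R : nat)%:R *
     ((`|complex.Im w / eta + Q%:R - b%:R| < 4)%R : nat)%:R)))/=.
  rewrite -big_distrlr/= (_ : 64 = 8 * 8); last by ring.
  have cn (t : R) : \sum_(a < 2 * Q) ((`|t - a%:R| < 4)%R : nat)%:R <= 8 :> R.
    rewrite -(big_mkord xpredT (fun a => ((`|t - a%:R| < 4)%R : nat)%:R)).
    by rewrite /index_iota subn0; exact: count_near.
  by apply: ler_pM => //; apply: sumr_ge0.
have Hge w : normc w <= M -> ln 2 <= H w.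
  move=> wM; have M0 : 0 <= M by apply: le_trans (normc_ge0 w) wM.
  rewrite ger0_norm// in MQ.
  have idx (x : R) : `|x| <= M -> exists a : 'I_(2 * Q), `|x - eta * (a%:R - Q%:R)| <= eta.
    move=> xM; pose u := x / eta + Q%:R.
    have ux : `|x / eta| <= M / eta.
      by rewrite normrM [X in _ * X]ger0_norm ?invr_ge0 ?(ltW eta0)// ler_pM2r ?invr_gt0.
    have [u0 u2] : 0 <= u /\ u < 2 * Q%:R.
      by move: ux; rewrite ler_norml /u => /andP[? ?]; split; lra.
    have uQ : (Num.truncn u < 2 * Q)%N.
      by rewrite -(ltr_nat R) natrM; apply: le_lt_trans u2; rewrite truncn_le.
    exists (Ordinal uQ) => /=.
    have /andP[b1 b2] := truncn_itv u0.
    have -> : x - eta * ((Num.truncn u)%:R - Q%:R) = eta * (u - (Num.truncn u)%:R).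
      by rewrite /u; field; rewrite gt_eqF.
    rewrite normrM (ger0_norm (ltW eta0)) ger_pMr// ler_norml.
    by move: b2; rewrite -natr1 => b2; apply/andP; split; lra.
  have [a xa] := idx _ (le_trans (le_Re_normc w) wM).
  have [b yb] := idx _ (le_trans (le_Im_normc w) wM).
  rewrite /H (bigD1 (a, b))//= -[leLHS]addr0; apply: lerD; last exact: sumr_ge0.
  have ab := normc_le_ReIm (w - ctr (a, b)).
  rewrite /h tent_near//; apply: le_trans ab _; case: w xa yb {wM} => x y /= xa yb.
  by rewrite (_ : 2 * eta = eta + eta); [exact: lerD|ring].
pose lam : R := (64 * ln 2)^-1.
have lam0 : 0 < lam by rewrite invr_gt0 mulr_gt0.
have lamH w : lam * H w <= 1 by rewrite mulrC ler_pdivrMr ?mulr_gt0// mul1r.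
pose F w := \sum_p (lam * f (ctr p)) * h p w.
exists F; split.
- by apply: span_sum => p; apply: VZ; exact: Vtent.
- apply: continuous_big => [|p _ w]; first exact: add_continuous.
  exact: (cvgMr (@continuous_tent R (ctr p) _ eta2 w)).
- move=> w; rewrite /F; apply: le_trans (ler_norm_sum _ _ _) _.
  apply: (@le_trans _ _ (B * (lam * H w))); last by rewrite -[leRHS]mulr1 ler_wpM2l// ltW.
  rewrite /H !mulr_sumr; apply: ler_sum => p _.
  rewrite !normrM (ger0_norm (ltW lam0)) (ger0_norm (h0 _ _)) mulrA [lam * _]mulrC.
  rewrite -!mulrA ler_wpM2r//.
  by rewrite mulr_ge0// ltW.
- move=> w wM.
  have -> : f w - F w = f w * (1 - lam * H w) + lam * \sum_p (f w - f (ctr p)) * h p w.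
    rewrite /F /H !mulr_sumr mulrBr mulr1 mulr_sumr -addrA; congr (_ + _).
    rewrite -!sumrN -big_split/=; apply: eq_bigr => p _; ring.
  apply: (@le_trans _ _ (B * (1 - lam * H w) + lam * (B / 128 * H w))).
    apply: le_trans (ler_normD _ _) _; apply: lerD.
      rewrite normrM [X in _ * X]ger0_norm ?subr_ge0// ler_wpM2r ?subr_ge0//.
    rewrite normrM (ger0_norm (ltW lam0)) ler_wpM2l ?(ltW lam0)//.
    apply: le_trans (ler_norm_sum _ _ _) _; rewrite /H mulr_sumr; apply: ler_sum => p _.
    rewrite normrM (ger0_norm (h0 _ _)).
    have [->|hn] := eqVneq (h p w) 0; first by rewrite !mulr0.
    rewrite ler_wpM2r// ltW// fs// normcBC (lt_trans (hfar _ _ hn))//.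
    by rewrite /eta; lra.
  (* With u = [lam * H w] in [1/64, 1] the error is at most B (1 - u + u / 128), which is below B (1
     - 1/128). *)
  have l64 : 1 / 64 <= lam * H w.
    have -> : 1 / 64 = lam * ln 2 by rewrite /lam; field; rewrite gt_eqF.
    by rewrite ler_wpM2l ?(ltW lam0)// Hge.
  have lH := lamH w; set u := lam * H w in l64 lH *.
  have -> : lam * (B / 128 * H w) = B / 128 * u by rewrite /u; ring.
  nra.
Qed.

End approximation.

Section approximation_iterated.
Variable R : realType.
Variable V : set (R[i] -> R).
Hypothesis VD : forall f g, V f -> V g -> V (fun w => f w + g w).
Hypothesis VZ : forall a f, V f -> V (fun w => a * f w).
Hypothesis Vtent : forall c r, 0 < r -> V (tent c r).

(* The error is truncated before the step is applied to it, so that the bounds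
   on the successive corrections are summable on the whole plane. *)
Lemma approximation_iter (f : R[i] -> R) (B M : R) k : continuous f -> 0 < B ->
  (forall w, `|f w| <= B) ->
  exists F, [/\ V F, forall w, `|F w| <= 128 * B &
    forall w, normc w <= M -> `|f w - F w| <= (127 / 128) ^+ k * B].
Proof.
elim: k f B => [|k IH] f B cf B0 fB.
  exists (fun=> 0); split; first exact: (span0 VZ Vtent).
    by move=> w; rewrite normr0 mulr_ge0// ltW.
  by move=> w _; rewrite subr0 expr0 mul1r.
have [F [VF cF FB fF]] := approximation_step VD VZ Vtent M cf B0 fB.
pose b := 127 / 128 * B; have b0 : 0 < b by rewrite mulr_gt0// divr_gt0.
pose clip (u : R) := Num.max (- b) (Num.min b u).
have cclip : continuous clip.
  move=> u; apply: (continuous_max (f := fun=> - b) (g := fun u => Num.min b u)).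
    exact: cvg_cst.
  by apply: (continuous_min (f := fun=> b) (g := fun u => u)); [exact: cvg_cst|exact: cvg_id].
pose g w := clip (f w - F w).
have cg : continuous g.
  move=> w; apply: (continuous_comp (f := fun w => f w - F w)); last exact: cclip.
  exact: cvgB (cf w) (cF w).
have gb w : `|g w| <= b.
  rewrite ler_norml /g /clip le_max lexx/= ge_max ge_min lexx/= andbT; lra.
have gE w : `|f w - F w| <= b -> g w = f w - F w.
  by rewrite ler_norml => /andP[h1 h2]; rewrite /g /clip min_r// max_r.
have [G [VG GB gG]] := IH g b cg b0 gb.
exists (fun w => F w + G w); split; first exact: VD.
  move=> w; apply: le_trans (ler_normD _ _) _.
  (* 128 is the sum of the geometric series of ratio 127/128. *)
  rewrite (_ : 128 * B = B + 128 * b); first exact: lerD.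
  by rewrite /b; field.
move=> w wM; rewrite opprD addrA -(gE _ (fF w wM)); apply: le_trans (gG w wM) _.
by rewrite exprSr -mulrA.
Qed.

Lemma approximation (f : R[i] -> R) (B M e : R) : continuous f -> 0 < B -> 0 < e ->
  (forall w, `|f w| <= B) ->
  exists F, [/\ V F, forall w, `|F w| <= 128 * B &
    forall w, normc w <= M -> `|f w - F w| <= e].
Proof.
move=> cf B0 e0 fB.
have q1 : `|127 / 128 : R| < 1 by rewrite ger0_norm ?divr_ge0// ltr_pdivrMr//; lra.
have h := cvg_expr q1; have eB : 0 < e / B by rewrite divr_gt0.
have [k _ /(_ k (leqnn k)) kP] : \forall k \near \oo, (127 / 128) ^+ k < e / B.
  exact: (cvgr_lt 0 h).
have [F [VF FB fF]] := approximation_iter M k cf B0 fB.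
exists F; split => // w wM; apply: le_trans (fF w wM) _.
by rewrite -ler_pdivlMr// ltW.
Qed.

End approximation_iterated.

(** * Law of large numbers for the critical points *)

Section critical_sums.
Context d (T : measurableType d) (R : realType) (P : probability T R).
Variables (mu : probability R[i] R) (X : nat -> {RV P >-> R[i]}).
Hypothesis X_indep : mutually_independent X.
Hypothesis X_distr : identically_distributed X mu.

(** This class is closed under linear combinations and contains the tents, so it can serve as [V] in
    [approximation]. *)
Definition crit_close (g : R[i] -> R) := forall e, 0 < e ->
  small_events P (fun n => [set w | e * n%:R <=
    `|\sum_(y <- crit (sample X n w)) g y - \sum_(x <- sample X n w) g x| ]).

Lemma crit_closeD f g : crit_close f -> crit_close g ->
  crit_close (fun w => f w + g w).
Proof.
move=> hf hg e e0; have e20 : 0 < e / 2 by rewrite divr_gt0.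
apply: small_events_sub (small_eventsU (hf _ e20) (hg _ e20)).
apply: nearW => n w /=; rewrite !big_split/= opprD addrACA.
set u := _ - _; set v := _ - _ => h.
have [|hu] := leP (e / 2 * n%:R) `|u|; first by left.
have [|hv] := leP (e / 2 * n%:R) `|v|; first by right.
by have := le_lt_trans (le_trans h (ler_normD _ _)) (ltrD hu hv); rewrite -mulrDl -splitr ltxx.
Qed.

Lemma crit_closeZ a g : crit_close g -> crit_close (fun w => a * g w).
Proof.
move=> hg e e0; have a0 : 0 < `|a| + 1 by rewrite ltr_wpDl.
have ea : 0 < e / (`|a| + 1) by rewrite divr_gt0.
apply: small_events_sub (hg _ ea); apply: nearW => n w /=.
rewrite -!mulr_sumr -mulrBr normrM => h.
rewrite mulrAC ler_pdivrMr//; apply: le_trans h _.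
by rewrite mulrC ler_wpM2l//; lra.
Qed.

Lemma crit_close_tent c r : 0 < r -> crit_close (tent c r).
Proof.
move=> r0 e e0; have e20 : 0 < e / 2 by rewrite divr_gt0.
have r20 : 0 < 2 * r by rewrite mulr_gt0.
apply: small_events_sub (small_eventsU
  (lnfar_convergence X_indep X_distr c r20 e20)
  (lnfar_convergence X_indep X_distr c r0 e20)).
apply: nearW => n w /=; rewrite !sumrB -!/(lnfar _ _ _).
set a := lnfar _ _ _; set b := lnfar _ _ _; set a' := lnfar _ _ _; set b' := lnfar _ _ _.
rewrite (_ : a - b - (a' - b') = (a - a') - (b - b')); last by ring.
set u := a - a'; set v := b - b' => h.
have [|hu] := leP (e / 2 * n%:R) `|u|; first by left.
have [|hv] := leP (e / 2 * n%:R) `|v|; first by right.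
by have := le_lt_trans (le_trans h (ler_normB _ _)) (ltrD hu hv); rewrite -mulrDl -splitr ltxx.
Qed.

(** The discs exhaust the plane, and the rescaled tent is a continuous cutoff above the indicator of
    a disc. As its sums over roots and critical points are close, it shows that neither lose mass at
    infinity. *)
Lemma tight_radius (a : R) : 0 < a ->
  exists2 r, 0 < r & 1 - a <= \int[mu]_w ((ln 2)^-1 * tent 0 r w).
Proof.
move=> a0; pose D (n : nat) := [set w : R[i] | normc w <= n%:R].
have mnorm : measurable_fun setT (fun w : R[i] => normc w).
  have -> : (fun w : R[i] => normc w) = (fun w => normc (w - 0)).
    by apply/funext => w; rewrite subr0.
  exact: (continuous_measurable_complex (@continuous_normcB _ 0)).
have mD n : measurable (D n).
  rewrite (_ : D n = (fun w => normc w) @^-1` `]-oo, n%:R]).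
    by rewrite -[X in measurable X]setTI; exact: mnorm.
  by apply/seteqP; split => w /=; rewrite in_itv.
have UD : \bigcup_n D n = setT.
  apply/seteqP; split => // w _; exists (Num.truncn (normc w)).+1 => //=.
  by apply/ltW; exact: truncnS_gt.
have : mu (D n) @[n --> \oo] --> mu (\bigcup_n D n).
  apply: nondecreasing_cvg_mu => //; first by rewrite UD.
  move=> n m nm; apply/subsetPset => w /=; rewrite /D/= => h.
  by apply: le_trans h _; rewrite ler_nat.
rewrite UD probability_setT => /fine_cvgP[_] /cvgrPdist_lt /(_ a a0) /= [n _ nP].
have := nP n.+1 (leqnSn n); rewrite /= => h.
exists n.+1%:R; first by rewrite ltr0n.
have n0 : 0 < n.+1%:R :> R by rewrite ltr0n.
have ln20 : 0 < ln 2 :> R by rewrite ln_gt0// ltr1n.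
have bt : bmeas (fun w => (ln 2)^-1 * tent 0 n.+1%:R w : R).
  apply: bmeasM; first exact: bmeas_cst.
  split; first by apply: continuous_measurable_complex; exact: continuous_tent.
  by exists (ln 2) => w; rewrite ger0_norm ?tent_ge0// tent_le.
apply: (@le_trans _ _ (\int[mu]_w (\1_(D n.+1) w : R))).
  rewrite /Rintegral integral_indic// setIT.
  by move: h; rewrite ltr_norml => /andP[_ h]; lra.
apply: bmeas_le => //; first exact: bmeas_indic.
move=> w; rewrite indicE; case: (boolP (w \in D n.+1)) => [/set_mem wD|_].
  by rewrite tent_near ?subr0// mulVf// gt_eqF.
by apply: mulr_ge0; [rewrite invr_ge0 ltW|exact: tent_ge0].
Qed.

End critical_sums.

Section critical_lln.
Context d (T : measurableType d) (R : realType) (P : probability T R).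
Variables (mu : probability R[i] R) (X : nat -> {RV P >-> R[i]}).
Hypothesis X_indep : mutually_independent X.
Hypothesis X_distr : identically_distributed X mu.

Lemma ler_sum_norm_seq (I : Type) (s : seq I) (g h : I -> R) :
  (forall w, `|g w| <= h w) -> `|\sum_(w <- s) g w| <= \sum_(w <- s) h w.
Proof.
by move=> gh; apply: le_trans (ler_norm_sum _ _ _) _; exact: ler_sum.
Qed.

Lemma critical_lln (f : R[i] -> R) (B e : R) : continuous f ->
  (forall w, `|f w| <= B) -> 0 < e ->
  small_events P (fun n => [set w | e * n%:R <=
    `|\sum_(y <- crit (sample X n w)) f y - n%:R * \int[mu]_x f x| ]).
Proof.
move=> cf fB0 e0; pose b := `|B| + 1.
have b0 : 0 < b by rewrite ltr_wpDl.
have fB w : `|f w| <= b.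
  by apply: le_trans (fB0 w) _; rewrite /b; have := ler_norm B; lra.
have [K bK] : exists K, 129 * b = K by exists (129 * b).
have K0 : 0 < K by lra.
(* K bounds |f - F| everywhere, as |f| <= b and |F| <= 128 b. Off the four events the sum of 1 -
   [chi] is at most 2 a n over the sample and 3 a n over the critical points, whence 5 K; the other
   errors are at most 4 a n, within the 6. *)
pose a := e / (6 + 5 * K).
have den0 : 0 < 6 + 5 * K by lra.
have a0 : 0 < a by rewrite divr_gt0.
have [r r0 tight] := tight_radius mu a0.
pose chi w := (ln 2)^-1 * tent 0 r w : R.
have ln20 : 0 < ln 2 :> R by rewrite ln_gt0// ltr1n.
have chi0 w : 0 <= chi w by apply: mulr_ge0; [rewrite invr_ge0 ltW|exact: tent_ge0].
have chi1 w : chi w <= 1 by rewrite /chi mulrC ler_pdivrMr// mul1r tent_le.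
have cchi : crit_close X chi.
  by apply: crit_closeZ; exact: (crit_close_tent X_indep X_distr).
have bchi : bmeas chi.
  apply: bmeasM; first exact: bmeas_cst.
  split; first by apply: continuous_measurable_complex; exact: continuous_tent.
  by exists (ln 2) => w; rewrite ger0_norm ?tent_ge0// tent_le.
have bf : bmeas f.
  by split; [exact: continuous_measurable_complex|exists b].
have [F [VF FB fF]] := @approximation R (crit_close X)
  (fun g h => @crit_closeD _ _ _ P X g h) (fun g h => @crit_closeZ _ _ _ P X g h)
  (fun c r r0 => @crit_close_tent _ _ _ P mu X X_indep X_distr c r r0)
  f b (2 * r) a cf b0 a0 fB.
(* [chi] vanishes where F no longer approximates f, so the second term pays there for the crude
   bound K. *)
have fFchi w : `|f w - F w| <= a + K * (1 - chi w).
  have [wr|wr] := leP (normc w) (2 * r).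
    apply: le_trans (fF w wr) _; rewrite lerDl mulr_ge0 ?(ltW K0)//.
    by rewrite subr_ge0.
  rewrite [chi w](_ : _ = 0); last by rewrite /chi (tent_far r0) ?mulr0 // subr0 ltW.
  apply: le_trans (ler_normB _ _) _; rewrite subr0 mulr1.
  by have := fB w; have := FB w; lra.
have E1 := VF a a0.
have E2 := cchi a a0.
have E3 := law_of_large_numbers X_indep X_distr bchi a0.
have E4 := law_of_large_numbers X_indep X_distr bf a0.
apply: small_events_sub (small_eventsU (small_eventsU E1 E2) (small_eventsU E3 E4)).
exists 1%N => // n /= n1 w /= h.
have nR : 0 < n%:R :> R by rewrite ltr0n.
have [k1|k1] := leP (a * n%:R) (`|\sum_(y <- crit (sample X n w)) F y -
  \sum_(x <- sample X n w) F x|); first by left; left.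
have [k2|k2] := leP (a * n%:R) (`|\sum_(y <- crit (sample X n w)) chi y -
  \sum_(x <- sample X n w) chi x|); first by left; right.
have [k3|k3] := leP (a * n%:R) (`|\sum_(j < n) chi (X j w) -
  n%:R * \int[mu]_x chi x|); first by right; left.
have [k4|k4] := leP (a * n%:R) (`|\sum_(j < n) f (X j w) -
  n%:R * \int[mu]_x f x|); first by right; right.
exfalso; move: h; apply/negP; rewrite -ltNge.
rewrite -(sum_sample X n w f) in k4; rewrite -(sum_sample X n w chi) in k3.
have sc : size (crit (sample X n w)) = n.-1.
  by apply: size_crit; rewrite size_sample prednK.
have ss : size (sample X n w) = n by exact: size_sample.
have bound s : `|\sum_(y <- s) f y - \sum_(y <- s) F y| <=
    a * (size s)%:R + K * ((size s)%:R - \sum_(y <- s) chi y).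
  rewrite -sumrB; apply: le_trans (ler_sum_norm_seq _ fFchi) _.
  rewrite big_split/= sum_const_seq mulrC lerD2l.
  have -> : \sum_(i <- s) K * (1 - chi i) = K * \sum_(i <- s) (1 - chi i).
    by rewrite mulr_sumr.
  by rewrite sumrB sum_const_seq mulr1.
have := bound (crit (sample X n w)); have := bound (sample X n w).
rewrite sc ss; move: k1 k2 k3 k4.
set Fc := \sum_(y <- crit _) F y; set Fs := \sum_(y <- sample _ _ _) F y.
set cc := \sum_(y <- crit _) chi y; set cs := \sum_(y <- sample _ _ _) chi y.
set fc := \sum_(y <- crit _) f y; set fs := \sum_(y <- sample _ _ _) f y.
set If := \int[mu]_x f x; set Ic := \int[mu]_x chi x.
rewrite !ltr_norml => /andP[k1 k1'] /andP[k2 k2'] /andP[k3 k3'] /andP[k4 k4'].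
set D1 := _ - cs; set D2 := _ - cc.
rewrite !ler_norml => /andP[l1 l1'] /andP[l2 l2'].
have nn : n.-1%:R <= n%:R :> R by rewrite ler_nat leq_pred.
have an0 : 0 <= a * (n%:R - n.-1%:R) by rewrite mulr_ge0 ?(ltW a0)// subr_ge0.
have tn : n%:R * (1 - a) <= n%:R * Ic by rewrite ler_wpM2l// ltW.
have d1 : D1 <= 2 * (a * n%:R) by rewrite /D1; lra.
have d2 : D2 <= 3 * (a * n%:R) by rewrite /D2; lra.
have m1 := ler_wpM2l (ltW K0) d1; have m2 := ler_wpM2l (ltW K0) d2.
have en : e * n%:R = (6 + 5 * K) * (a * n%:R).
  by rewrite /a; field; rewrite gt_eqF.
have an1 : 0 < a * n%:R by rewrite mulr_gt0.
by apply/andP; split; rewrite en; lra.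
Qed.

End critical_lln.

(** * Continuity of roots and measurability *)

Section roots_continuity.
Variable R : realType.
Context (I : Type) (F : set_system I) {FF : Filter F}.
Implicit Types (a b : R[i]) (s : seq R[i]).

Definition monic_of s : {poly R[i]} := \prod_(z <- s) ('X - z%:P).

Lemma exists_nearest a s : (0 < size s)%N ->
  exists2 b, b \in s & forall z, z \in s -> normc (a - b) <= normc (a - z).
Proof.
elim: s => // y [|y' s] IH _.
  by exists y; [exact: mem_head|move=> z; rewrite in_cons orbF => /eqP->].
have [b bs bmin] := IH isT.
have [h|h] := leP (normc (a - b)) (normc (a - y)).
  exists b; first by rewrite in_cons bs orbT.
  by move=> z; rewrite in_cons => /orP[/eqP->//|]; exact: bmin.
exists y; first exact: mem_head.
move=> z; rewrite in_cons => /orP[/eqP->//|zs].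
by apply: le_trans (ltW h) _; exact: bmin.
Qed.

Lemma cvg_normcP (u : I -> R[i]) (l : R[i]) :
  u @ F --> l <-> forall e, 0 < e -> \forall i \near F, normc (u i - l) < e.
Proof.
split=> [ul e e0|ul].
  by have := ul _ (near_normc l e0).
move=> A /nbhs_normc[e e0 eA]; have := ul e e0.
by apply: filterS => i; exact: eA.
Qed.

Lemma monic_of_cons a s : monic_of (a :: s) = ('X - a%:P) * monic_of s.
Proof. by rewrite /monic_of big_cons. Qed.

Lemma size_monic_of s : size (monic_of s) = (size s).+1.
Proof. exact: size_prod_XsubC. Qed.

Lemma coef_monic_of_cons a s k :
  (monic_of s)`_k = (monic_of (a :: s))`_k.+1 + a * (monic_of s)`_k.+1.
Proof. by rewrite monic_of_cons mulrBl coefB coefXM coefCM/= subrK. Qed.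

(* Split off from [t i] the root closest to the head of [s]. *)
Lemma cvg_sum_roots (f : R[i] -> R) (s : seq R[i]) (t : I -> seq R[i]) :
  continuous f -> (forall i, size (t i) = size s) ->
  (forall k, (monic_of (t i))`_k @[i --> F] --> (monic_of s)`_k) ->
  \sum_(z <- t i) f z @[i --> F] --> \sum_(z <- s) f z.
Proof.
move=> cf; elim: s t => [|a s IH] t st tk.
  rewrite big_nil (_ : (fun _ => _) = fun=> 0); first exact: cvg_cst.
  by apply/funext => i; rewrite (size0nil (st i)) big_nil.
have exb i : exists b, b \in t i /\ forall z, z \in t i -> normc (a - b) <= normc (a - z).
  have [|b bt bmin] := @exists_nearest a (t i); first by rewrite st.
  by exists b.
have [b bP] := choice exb.
have bt i : b i \in t i by have [] := bP i.
pose t' i := rem (b i) (t i).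
have tE i : perm_eq (t i) (b i :: t' i) by exact: perm_to_rem.
have mE i : monic_of (t i) = monic_of (b i :: t' i) by apply: perm_big.
(* The value of [monic_of (t i)] at a tends to 0, and its modulus is at least |a - b i| to the power
   of the degree, since b i is the nearest root. *)
have ba : b i @[i --> F] --> a.
  apply/cvg_normcP => e e0.
  have em : 0 < e ^+ (size s).+1 by rewrite exprn_gt0.
  have ta : (monic_of (t i)).[a] @[i --> F] --> (monic_of (a :: s)).[a].
    rewrite (@horner_coef_wide _ (size s).+2); last by rewrite size_monic_of.
    rewrite (_ : (fun _ => _) = fun i => \sum_(j < (size s).+2) (monic_of (t i))`_j * a ^+ j).
      apply: cvg_big => [|j _]; first exact: add_continuous.
      by apply: cvgMl; exact: tk.
    apply/funext => i; rewrite (@horner_coef_wide _ (size s).+2)//.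
    by rewrite size_monic_of st.
  have /cvg_normcP/(_ _ em) := ta; apply: filterS => i.
  rewrite (_ : (monic_of (a :: s)).[a] = 0); last first.
    by rewrite monic_of_cons !hornerE subrr mul0r.
  rewrite subr0 => h; rewrite -(@ltr_pXn2r _ (size s).+1)// ?nnegrE ?normc_ge0 ?(ltW e0)//.
  apply: le_lt_trans h; rewrite /monic_of horner_prod normc_prod.
  rewrite -[X in _ ^+ X](st i) -prod_const_seq big_seq [leRHS]big_seq.
  apply: ler_prod => z zt; rewrite normc_ge0 normcBC !hornerE.
  by have [_ ->] := bP i.
have t'k k : (monic_of (t' i))`_k @[i --> F] --> (monic_of s)`_k.
  have st' i : size (t' i) = size s by rewrite size_rem// st.
  have big0 u j : size u = size s -> (size s < j)%N -> (monic_of u)`_j = 0.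
    by move=> su js; rewrite nth_default// size_monic_of su.
  (* Synthetic division determines the coefficients of the quotient from the top down, so the
     induction descends in j from the zero coefficients beyond the degree. *)
  suff : forall m j, (size s < j + m)%N ->
      (monic_of (t' i))`_j @[i --> F] --> (monic_of s)`_j.
    by move=> h; apply: (h (size s).+1); rewrite addnS ltnS leq_addl.
  elim=> [|m IHm] j.
    rewrite addn0 => sj; rewrite (big0 s j erefl sj).
    rewrite (_ : (fun _ => _) = fun=> 0); first exact: cvg_cst.
    by apply/funext => i; rewrite (big0 _ j (st' i) sj).
  rewrite addnS -addSn => sj.
  rewrite (coef_monic_of_cons a).
  rewrite (_ : (fun _ => _) = fun i => (monic_of (t i))`_j.+1 + b i * (monic_of (t' i))`_j.+1).
    exact: (cvgD (tk j.+1) (cvgM ba (IHm j.+1 sj))).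
  by apply/funext => i; rewrite mE -coef_monic_of_cons.
rewrite big_cons.
rewrite (_ : (fun _ => _) = fun i => f (b i) + \sum_(z <- t' i) f z).
  apply: cvgD; first exact: (@cvg_comp _ _ _ b f F _ _ ba (cf a)).
  by apply: IH => // i; rewrite size_rem// st.
by apply/funext => i; rewrite (perm_big _ (tE i)) big_cons.
Qed.

Lemma cvg_coef_monic_of (x : I -> nat -> R[i]) (y : nat -> R[i]) n :
  (forall j, (j < n)%N -> x i j @[i --> F] --> y j) ->
  forall k, (poly_of (x i) n)`_k @[i --> F] --> (poly_of y n)`_k.
Proof.
elim: n => [|n IH] xy k.
  rewrite /poly_of big_ord0 (_ : (fun _ => _) = fun=> (1 : {poly R[i]})`_k).
    exact: cvg_cst.
  by apply/funext => i; rewrite big_ord0.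
have xy' j : (j < n)%N -> x i j @[i --> F] --> y j by move=> jn; apply: xy; exact: ltnW.
have E (z : nat -> R[i]) : (poly_of z n.+1)`_k =
    (if k is k'.+1 then (poly_of z n)`_k' else 0) - (poly_of z n)`_k * z n.
  rewrite /poly_of big_ord_recr/= mulrBr coefB coefMX coefMC.
  by case: k.
rewrite E (_ : (fun _ => _) = fun i => (if k is k'.+1 then (poly_of (x i) n)`_k' else 0)
    - (poly_of (x i) n)`_k * x i n); last by apply/funext => i; rewrite E.
apply: cvgB.
  by case: k {E} => [|k']; [exact: cvg_cst|exact: IH].
by apply: cvgM; [exact: IH|exact: xy].
Qed.

Lemma coef_monic_roots_of_deriv (x : nat -> R[i]) n k :
  (monic_of (roots_of (poly_of x n.+1)^`()))`_k =
  n.+1%:R^-1 * ((poly_of x n.+1)`_k.+1 * k.+1%:R).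
Proof.
rewrite mulr_natr -coef_deriv /roots_of; case: closed_field_poly_normal => t /= tE.
rewrite [in RHS]tE lead_coefE size_deriv_poly_of coef_deriv/=.
have : lead_coef (poly_of x n.+1) = 1 by apply/monicP/monic_prod_XsubC.
rewrite lead_coefE size_poly_of/= => ->.
by rewrite coefZ mulrA mulVf ?mul1r// pnatr_eq0.
Qed.

Lemma cvg_sum_critical (f : R[i] -> R) (x : I -> nat -> R[i]) (y : nat -> R[i]) n :
  continuous f ->
  (forall j, (j < n.+1)%N -> x i j @[i --> F] --> y j) ->
  \sum_(z <- roots_of (poly_of (x i) n.+1)^`()) f z @[i --> F] -->
  \sum_(z <- roots_of (poly_of y n.+1)^`()) f z.
Proof.
move=> cf xy; apply: cvg_sum_roots => //; first by move=> i; rewrite !size_roots_of_deriv.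
move=> k; rewrite coef_monic_roots_of_deriv.
rewrite (_ : (fun _ => _) = fun i => n.+1%:R^-1 * ((poly_of (x i) n.+1)`_k.+1 * k.+1%:R)).
  by apply: cvgMr; apply: cvgMl; exact: cvg_coef_monic_of.
by apply/funext => i; exact: coef_monic_roots_of_deriv.
Qed.

End roots_continuity.

(** * Integration against critical measures and the weak topology *)

Section critical_integral.
Variable R : realType.

Lemma ge0_integral_critical (x : nat -> R[i]) n (h : R[i] -> R) :
  measurable_fun setT h -> (forall z, 0 <= h z) ->
  (\int[critical_measure x n.+2]_z (h z)%:E)%E =
  (n.+1%:R^-1 * \sum_(z <- roots_of (poly_of x n.+2)^`()) h z)%:E.
Proof.
move=> mh h0; have r0 : 0 <= n.+1%:R^-1 :> R by rewrite invr_ge0.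
pose s := roots_of (poly_of x n.+2)^`().
pose m := mscale (NngNum r0) (msum (fun j => \d_(nth 0 s j)) (size s)).
have mEh : measurable_fun setT (EFin \o h) by exact/measurable_EFinP.
rewrite (eq_measure_integral m); last first.
  move=> A _ _; rewrite /m/= /critical_measure /mscale /msum/= -/s.
  by rewrite (big_nth 0) big_mkord.
rewrite /m ge0_integral_mscale//=; last by move=> z _; rewrite lee_fin.
rewrite ge0_integral_measure_sum//; last by move=> z _; rewrite lee_fin.
rewrite EFinM -/s (big_nth 0) big_mkord -sumEFin; congr (_ * _)%E.
by apply: eq_bigr => j _; rewrite integral_dirac//= diracT mul1e.
Qed.

(** Adding a bound B of |f| reduces to the nonnegative case; the total mass 1 allows B to be
    subtracted again. *)
Lemma Rintegral_critical (x : nat -> R[i]) n (f : R[i] -> R) : bmeas f ->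
  \int[critical_measure x n.+2]_z f z =
  n.+1%:R^-1 * \sum_(z <- roots_of (poly_of x n.+2)^`()) f z.
Proof.
move=> bf; have [mf [B fB]] := bf.
have bB : bmeas (fun _ : R[i] => B) by exact: bmeas_cst.
pose P : probability R[i] R := critical_measure x n.+2.
have intE (g : R[i] -> R) : bmeas g -> P.-integrable setT (EFin \o g).
  exact: bmeas_integrable.
have -> : \int[critical_measure x n.+2]_z f z = \int[P]_z (f z + B) - B.
  rewrite RintegralD//; [|exact: intE|exact: intE].
  by rewrite Rintegral_prob_cst addrK.
rewrite {1}/Rintegral ge0_integral_critical/=; last 2 first.
- by apply: measurable_funD => //; exact: measurable_cst.
- by move=> z; have := fB z; rewrite ler_norml => /andP[? _]; lra.
rewrite big_split/= mulrDr sum_const_seq size_roots_of_deriv mulKf ?addrK//.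
Qed.

Lemma bmeas_bounded_continuous (f : bounded_continuous R) : bmeas (sval f).
Proof.
case: f => f [/= cf [M [_ fM]]]; split; first exact: continuous_measurable_complex.
by exists (M + 1) => z; apply: fM => //; rewrite ltrDl.
Qed.

(** Weak convergence is tested on one f at a time. It is stated for a general filter because it
    serves twice: for roots approaching a given configuration, and for the sets of measures that are
    missed with small probability. *)
Lemma open_weak_filter (F : set_system (weak_probability R)) (nu : weak_probability R)
    (U : set (weak_probability R)) : Filter F -> open U -> U nu ->
  (forall f : bounded_continuous R,
    (fun m : weak_probability R => @integral_map R m f) @ F --> @integral_map R nu f) ->
  F U.
Proof.
move=> FF [V oV <-] Vnu cvF.
pose G := (@integral_map R : weak_probability R -> _) @ F.
suff : G --> (@integral_map R nu : {ptws bounded_continuous R -> R}).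
  by apply; apply: open_nbhs_nbhs.
apply/cvg_sup => f; apply/cvg_image.
  by apply/seteqP; split => // v _; exists (fun=> v).
move=> W /= /(cvF f) FW; exists ((fun g => g f) @^-1` W) => //.
apply/seteqP; split => [v [g gW <-]//|v Wv].
by exists (fun=> v).
Qed.

End critical_integral.

Section measurable_boxes.
Context d (T : measurableType d) (R : realType).
Variable X : nat -> {mfun T >-> R[i]}.

Lemma rat_near (x e : R) : 0 < e -> exists q : rat, `|x - ratr q| < e.
Proof.
move=> e0; have [|q] := @rat_in_itvoo R (x - e) (x + e).
  by rewrite ltrBlDr -addrA ltrDl addr_gt0.
rewrite in_itv/= => /andP[q1 q2]; exists q.
by rewrite ltr_norml; apply/andP; split; lra.
Qed.

(** G is open in the first n coordinates, hence a countable union of boxes with rational centres and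
    radii 1 / (k + 1); the preimage of a box is a finite intersection of measurable events. *)
Lemma measurable_box_open (G : set (nat -> R[i])) n :
  (forall y, G y -> exists2 e, 0 < e &
    forall x, (forall j, (j < n)%N -> normc (x j - y j) < e) -> G x) ->
  measurable [set w | G (fun j => X j w)].
Proof.
move=> oG.
pose ctr (p : rat * rat) : R[i] := ratr p.1 +i* ratr p.2.
pose box (u : seq (rat * rat) * nat) : set (nat -> R[i]) :=
  [set x | forall j, (j < n)%N -> normc (x j - ctr (nth 0 u.1 j)) < u.2.+1%:R^-1].
pose S (u : seq (rat * rat) * nat) : set T :=
  [set w | box u `<=` G /\ box u (fun j => X j w)].
have -> : [set w | G (fun j => X j w)] = \bigcup_u S u.
  apply/seteqP; split => [w /= Gw|w [u _] [uG uw]]; last exact: uG.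
  have [e e0 eG] := oG _ Gw.
  have e20 : 0 < e / 2 by rewrite divr_gt0.
  pose k := Num.truncn (e / 2)^-1.
  have ke : k.+1%:R^-1 < e / 2 :> R.
    by rewrite invf_plt ?posrE//; exact: truncnS_gt.
  pose t : R := k.+1%:R^-1 / 2; have t0 : 0 < t by rewrite divr_gt0 ?invr_gt0.
  have exq j : exists p : rat * rat, normc (X j w - ctr p) < k.+1%:R^-1.
    have [q1 h1] := rat_near (complex.Re (X j w)) t0.
    have [q2 h2] := rat_near (complex.Im (X j w)) t0.
    exists (q1, q2); apply: le_lt_trans (normc_le_ReIm _) _.
    rewrite [ltRHS](_ : _ = t + t); last by rewrite /t -splitr.
    by move: h1 h2; case: (X j w) => a b /= h1 h2; exact: ltrD.
  have [p pP] := choice exq.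
  exists ([seq p j | j <- iota 0 n], k) => //.
  have nthp j : (j < n)%N -> nth 0 [seq p j | j <- iota 0 n] j = p j.
    by move=> jn; rewrite (nth_map 0%N) ?size_iota// nth_iota.
  split; last by move=> j jn /=; rewrite nthp//.
  move=> x /= xbox; apply: eG => j jn; have := xbox j jn; rewrite /= nthp// => xp.
  rewrite -(subrK (ctr (p j)) (x j)) -addrA; apply: le_lt_trans (normcD _ _) _.
  rewrite [ctr _ - _](_ : _ = - (X j w - ctr (p j))); last by rewrite opprB.
  rewrite normcN [e]splitr; apply: ltrD; first exact: lt_trans ke.
  by apply: lt_trans ke; exact: pP.
apply: countable_bigcupT_measurable; first exact: countableP.
move=> u; have [uG|uG] := pselect (box u `<=` G); last first.
  by rewrite (_ : S u = set0)//; apply/seteqP; split => // w [].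
have -> : S u = \bigcap_(j in [set j | (j < n)%N])
    ((fun w => normc (X j w - ctr (nth 0 u.1 j))) @^-1` `]-oo, u.2.+1%:R^-1[).
  apply/seteqP; split => [w [_ uw] j jn|w h]; rewrite /=.
    by rewrite in_itv/=; exact: uw.
  by split => // j jn; have := h j jn; rewrite /= in_itv.
apply: fin_bigcap_measurable; first exact: finite_II.
move=> j _; rewrite -[X in measurable X]setTI.
have mj : measurable_fun setT (fun w => normc (X j w - ctr (nth 0 u.1 j))).
  apply: (measurableT_comp (continuous_measurable_complex (@continuous_normcB R _))).
  exact: measurable_funPT.
exact: mj.
Qed.

End measurable_boxes.

(** * Convergence in probability of the critical measures *)

Section empirical_critical_measure.
Context d (T : measurableType d) (R : realType) (P : probability T R).
Variables (mu : probability R[i] R) (X : nat -> {RV P >-> R[i]}).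
Hypothesis X_indep : mutually_independent X.
Hypothesis X_distr : identically_distributed X mu.

Let mu_ n w : weak_probability R :=
  (critical_measure (fun j => X j w) n.+2 : probability R[i] R).

Lemma crit_sampleE n w : crit (sample X n w) = roots_of (poly_of (fun j => X j w) n)^`().
Proof.
by rewrite /crit /sample big_map -[X in iota _ X](subn0 n) big_mkord.
Qed.

(** The critical measure depends continuously on the first n + 2 points, by continuity of roots, so
    the event is the preimage of an open set of configurations. *)
Lemma measurable_critical_event (U : set (weak_probability R)) n : open U ->
  measurable [set w | U (mu_ n w)].
Proof.
move=> oU.
apply: (@measurable_box_open _ _ _ X (fun x => U (critical_measure x n.+2 : probability R[i] R)) n.+2).
move=> y Uy.
pose Fb : set_system (nat -> R[i]) := filter_from [set e : R | 0 < e]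
  (fun e => [set x | forall j, (j < n.+2)%N -> normc (x j - y j) < e]).
have FbF : Filter Fb.
  apply: filter_from_filter; first by exists 1 => /=.
  move=> i j /= i0 j0; exists (Num.min i j); first by rewrite /= lt_min i0.
  by move=> x h; split => k kn; have := h k kn; rewrite lt_min => /andP[].
pose cm (x : nat -> R[i]) : weak_probability R := (critical_measure x n.+2 : probability R[i] R).
suff : (cm @ Fb) U by move=> [e e0 eU]; exists e.
apply: (@open_weak_filter _ _ (cm y)) => // f.
have bf := bmeas_bounded_continuous f.
have cE x : integral_map (cm x) f =
    n.+1%:R^-1 * \sum_(z <- roots_of (poly_of x n.+2)^`()) sval f z.
  exact: Rintegral_critical.
rewrite cE; rewrite (_ : _ @ _ = (fun x => integral_map (cm x) f) @ Fb)//.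
under eq_cvg do rewrite cE.
apply: cvgMr; apply: cvg_sum_critical; first by case: f {bf cE} => ? [].
move=> j jn; apply/cvg_normcP => e e0; exists e => //= x; exact.
Qed.

(** The sets that the critical measure misses only on small events form a filter; finite
    intersections correspond to finite unions of small events. Its convergence to mu then follows
    from [critical_lln] for each f separately. *)
Lemma critical_measure_small (U : set (weak_probability R)) : open U ->
  U (mu : weak_probability R) -> small_events P (fun n => [set w | ~ U (mu_ n w)]).
Proof.
move=> oU Umu.
pose F0 : set_system (weak_probability R) :=
  [set A | small_events P (fun n => [set w | ~ A (mu_ n w)])].
have F0F : Filter F0.
  split.
  - move=> e e0; apply: nearW => n; exists set0; split => //; first by move=> w; exact.
    by rewrite measure0 lee_fin ltW.
  - move=> A B hA hB; apply: small_events_sub (small_eventsU hA hB).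
    apply: nearW => n w /= nAB; apply: contrapT => h; apply: nAB; split.
      by apply: contrapT => nA; apply: h; left.
    by apply: contrapT => nB; apply: h; right.
  - move=> A B AB hA; apply: small_events_sub hA; apply: nearW => n w /= nB Aw.
    by apply: nB; exact: AB.
apply: (@open_weak_filter _ F0 (mu : weak_probability R)) => // f.
have bf := bmeas_bounded_continuous f.
have cf : continuous (sval f) by case: f {bf} => ? [].
have [_ [B fB]] := bf.
set m := integral_map _ f.
apply/cvgrPdist_lt => /= e e0.
(* The measure divides by n + 1, while [critical_lln] compares the sum with n + 2 times the mean m.
   The surplus |m| is absorbed for large n by passing from e to e / 4. *)
have e40 : 0 < e / 4 by rewrite divr_gt0.
have := small_events_shift 2 (critical_lln X_indep X_distr cf fB e40).
rewrite -[\int[mu]_x _]/m.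
apply: small_events_sub; near=> n => w /=.
rewrite crit_sampleE addn2.
have -> : integral_map (mu_ n w) f =
    n.+1%:R^-1 * \sum_(z <- roots_of (poly_of (fun j => X j w) n.+2)^`()) sval f z.
  exact: Rintegral_critical.
set S := \sum_(z <- _) _ => /negP; rewrite -leNgt => h.
have nR : 0 < n.+1%:R :> R by rewrite ltr0n.
have h1 : e * n.+1%:R <= `|S - n.+1%:R * m|.
  rewrite distrC [X in Num.norm X](_ : _ = (m - n.+1%:R^-1 * S) * n.+1%:R); last first.
    by field; rewrite gt_eqF.
  by rewrite normrM (gtr0_norm nR) ler_wpM2r// ltW.
have h2 : `|S - n.+1%:R * m| <= `|S - n.+2%:R * m| + `|m|.
  apply: le_trans (ler_normD _ _); rewrite le_eqVlt; apply/orP; left; apply/eqP.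
  by congr Num.norm; rewrite -[n.+2%:R]natr1; ring.
have n2 : n.+2%:R = n.+1%:R + 1 :> R by rewrite natr1.
have nbig : 4 * `|m| / e + 1 < n.+1%:R.
  by apply: (@lt_trans _ _ n%:R); [near: n; exact: nbhs_infty_gtr|rewrite ltr_nat].
rewrite -ltrBrDr ltr_pdivrMr// in nbig.
have en : e <= e * n.+1%:R by rewrite ler_peMr ?ler1n// ltW.
by rewrite n2 in h2 *; lra.
Unshelve. all: by end_near. Qed.

End empirical_critical_measure.

Theorem theorem1p1 (R : realType) (d : measure_display)
    (Omega : measurableType d) (P : probability Omega R)
    (mu : probability R[i] R) (X : nat -> {RV P >-> R[i]})
    (X_indep : mutually_independent X)
    (X_distr : identically_distributed X mu)
    (U : set (weak_probability R)) (U_open : open U)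
    (U_mu : U (mu : weak_probability R)) :
  P [set w : Omega |
      ~ U (critical_measure (fun j => X j w) n.+2 : probability R[i] R)]
    @[n --> \oo] --> 0%E.
Proof.
(* Measurability allows the probability of the event to be bounded by that of its measurable
   cover. *)
have mA n : measurable [set w : Omega |
    ~ U (critical_measure (fun j => X j w) n.+2 : probability R[i] R)].
  by apply: measurableC; exact: (measurable_critical_event X n U_open).
have small := critical_measure_small X_indep X_distr U_open U_mu.
apply/fine_cvgP; split; first by apply: nearW => n; rewrite fin_num_measure.
apply/cvgrPdist_le => /= e e0; apply: filterS (small e e0) => n [B [mB AB PB]].
rewrite sub0r normrN ger0_norm ?fine_ge0// -lee_fin fineK ?fin_num_measure//.
by apply: le_trans PB; rewrite le_measure ?inE.
Qed.
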